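(* Let $X$ be an infinite-dimensional F-space (over $\mathbb R$ or $\mathbb C$). If $X$ contains no unconditional basic sequence, then $X$ contains an infinite-dimensional closed subspace which is hereditarily indecomposable (HI).
   Context: An F-space is a complete metrizable topological vector space (complete metric linear space); no local convexity is assumed. A sequence in $X$ is a basic sequence if it is a Schauder basis of its closed linear span; it is an unconditional basic sequence if it is an unconditional Schauder basis of its closed linear span. Two subspaces $V,W$ of an F-space are separated if $V\cap W=\{0\}$ and the canonical projection $V+W\to V$ is continuous (for closed $V,W$ with $V\cap W=\{0\}$ this is equivalent to $V+W$ being closed). An F-space is hereditarily indecomposable (HI) if it contains no two infinite-dimensional closed subspaces $V,W$ that are separated. *)

(* Defs.v *)
From mathcomp Require Import all_boot all_order all_algebra.
From mathcomp Require Import complex.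
From mathcomp Require Import all_classical all_reals all_analysis.

Set Implicit Arguments.
Unset Strict Implicit.
Unset Printing Implicit Defensive.

Import Order.TTheory GRing.Theory Num.Theory.

Local Open Scope classical_set_scope.
Local Open Scope ring_scope.

Definition metrizable (R : realType) (T : topologicalType) : Prop :=
  exists d : T -> T -> R,
    [/\ forall x y, d x y = 0 <-> x = y,
        forall x y, d x y = d y x,
        forall x y z, d x z <= d x y + d y z &
        forall x, nbhs x = filter_from [set e : R | 0 < e]
                             (fun e => [set y | d x y < e])].

Section Fspace.
Variables (K : numFieldType) (X : topologicalLmodType K).
Implicit Types (V W Y A : set X) (e u : nat -> X) (x : X).

(* Cauchy filters for the canonical (translation-invariant) uniformity of the
   vector topology. *)
Definition tvs_cauchy (F : set_system X) : Prop :=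
  forall U, nbhs (0 : X) U ->
    exists2 A, F A & forall x y, A x -> A y -> U (x - y).

Definition tvs_complete : Prop :=
  forall F : set_system X, ProperFilter F -> tvs_cauchy F -> exists x : X, F --> x.

Definition linear_subspace V : Prop :=
  V 0 /\ forall (a : K) x y, V x -> V y -> V (a *: x + y).

Definition lin_span A : set X :=
  [set x | exists (n : nat) (v : 'I_n -> X) (a : 'I_n -> K),
     (forall i, A (v i)) /\ x = \sum_(i < n) a i *: v i].

Definition infinite_dim V : Prop :=
  ~ exists2 A, finite_set A & V = lin_span A.

Definition closed_span e : set X := closure (lin_span (range e)).

Definition schauder_basis Y e : Prop :=
  (forall n, Y (e n)) /\
  forall x, Y x ->
    exists! a : nat -> K, series (fun i => a i *: e i) @ \oo --> x.

Definition unconditionally_cvg u x : Prop :=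
  forall s : nat -> nat, bijective s -> series (u \o s) @ \oo --> x.

Definition unconditional_schauder_basis Y e : Prop :=
  schauder_basis Y e /\
  forall x (a : nat -> K), Y x -> series (fun i => a i *: e i) @ \oo --> x ->
    unconditionally_cvg (fun i => a i *: e i) x.

Definition unconditional_basic_sequence e : Prop :=
  unconditional_schauder_basis (closed_span e) e.

(* The values of p outside V + W are irrelevant: {within _, continuous _} only
   depends on the restriction of p to V + W. *)
Definition separated_subspaces V W : Prop :=
  V `&` W = [set 0] /\
  exists p : X -> X,
    (forall v w, V v -> W w -> p (v + w) = v) /\
    {within [set v + w | v in V & w in W], continuous p}.

(* For Y a closed subspace of X: subspaces of Y are closed in Y if and only if
   they are closed in X. *)
Definition hereditarily_indecomposable Y : Prop :=
  ~ exists V W,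
      [/\ V `<=` Y /\ W `<=` Y,
          [/\ linear_subspace V, closed V & infinite_dim V],
          [/\ linear_subspace W, closed W & infinite_dim W] &
          separated_subspaces V W].

End Fspace.

(* No local convexity, and the metric is not required to be invariant. *)
Definition F_space (R : realType) (K : numFieldType)
    (X : topologicalLmodType K) : Prop :=
  metrizable R X /\ tvs_complete X.

(* Main.v *)
Require Import Defs.
From mathcomp Require Import all_boot all_order all_algebra.
From mathcomp Require Import complex zify.
From mathcomp Require Import all_classical all_reals all_analysis.

(** Assume that no infinite-dimensional closed subspace is hereditarily
    indecomposable. An unconditional basic sequence is then constructed, after
    Maurey's proof of Gowers' dichotomy.

    Fix a base of balanced neighbourhoods [U n] of [0] with
    [U n.+1 + U n.+1 `<=` U n], and write [sep m n V W] when [v + w] in [U m]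
    forces [v] and [w] into [U n]. In a normed space a single constant measures
    the separation of two subspaces; here separation means that for every [n]
    there is [m] with [sep m n V W], and the function from [n] to [m] depends on
    the pair. Nonzero vectors form an unconditional basis of their closed span if
    for every [n] some [m] works for all pairs of spans of disjoint sets of
    terms ([suppressible_unconditional]); by [suppressible_of_tail], it is enough
    to control the sets of terms beyond an index depending on [n], once the
    coefficient functionals are continuous.

    The heart of the matter is [maurey_sequence]. The next vector [x] is chosen
    so that, for all [j] up to the current index and each partition [(A, B)] of
    the terms chosen since the [j]-th one, their spans [E_A] and [E_B] are part
    of a pair [(E_A + V, E_B + W)] satisfying [sep] with the constants attached
    to [j]. A fusion argument ([fusion_stabilize]) passes to a space [Z] where
    the existence of [V] and [W] inside [Z] implies their existence inside every
    subspace of [Z]. Hence the finitely many conditions can be treated one after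
    the other, each time inside the [V] obtained before, and any [x] in the last
    of these spaces can be added to all the [E_A]. Treating each [j] by its own
    pairs [(V, W)] is what avoids a choice of constants for all [n] at once.

    Stabilization requires countably many conditions, and exactness leaves no
    room for approximating [x]. So the construction is carried out among
    submodules, over a countable dense subring of the scalars, of a countable
    module. The hypothesis speaks of closed subspaces, though, and a closed
    subspace of the closure of the module need not meet it. The passage from the
    former to the latter ([split_submodule]) is a perturbation argument, for
    which a basic sequence would be convenient, but the space might contain
    none. Its substitute is a sequence whose coefficients are bounded on one
    fixed neighbourhood ([regular]). If every [U n] contains a line, a greedy
    choice of lines already spans an unconditional basic sequence
    ([short_lines_unconditional]). Otherwise [U 0] may be assumed to contain no
    line, and a first fusion, among closed subspaces, yields a space in which
    all closed subspaces contain pairs with [sep m 0] for a fixed [m]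
    ([uniform_pairs]); splitting repeatedly produces regular sequences
    ([regular_sequence]), and these survive small perturbations ([perturb]). *)

Set Implicit Arguments.
Unset Strict Implicit.
Unset Printing Implicit Defensive.

Import Order.TTheory GRing.Theory Num.Theory.
Import numFieldNormedType.Exports.

Local Open Scope classical_set_scope.
Local Open Scope ring_scope.

(** * Countable bases of balanced neighbourhoods *)

(** The vector topology is used only through such a sequence [U]. The additive
    halving [base_add] plays the role of the triangle inequality: a series
    whose terms lie in [U n.+1], [U n.+2], ... has its sums in [U n]. *)
Record balanced_base (K : numFieldType) (X : topologicalLmodType K)
    (U : nat -> set X) : Prop := {
  base_balanced : forall n (a : K) x, `|a| <= 1 -> U n x -> U n (a *: x);
  base_add : forall n x y, U n.+1 x -> U n.+1 y -> U n (x + y);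
  base_separates : forall x, (forall n, U n x) -> x = 0;
  base_scale : forall n (c : K), exists m, forall x, U m x -> U n (c *: x);
  base_absorb : forall n x, exists2 e : K, 0 < e &
    forall c, `|c| <= e -> U n (c *: x);
  base_nbhs : forall x A, nbhs x A <-> exists n, forall y, U n (y - x) -> A y }.

Section Base.
Variables (K : numFieldType) (X : topologicalLmodType K) (U : nat -> set X).
Hypothesis hU : balanced_base U.

Lemma base0 n : U n 0.
Proof.
have [e e0 /(_ 0)] := base_absorb hU n 0.
by rewrite normr0 scaler0; apply; exact: ltW.
Qed.

Lemma base_le m n : (m <= n)%N -> U n `<=` U m.
Proof.
elim: n => [|n IHn]; first by rewrite leqn0 => /eqP->.
rewrite leq_eqVlt => /orP[/eqP->//|]; rewrite ltnS => /IHn h x Ux.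
by apply: h; rewrite -(addr0 x); apply: (base_add hU) => //; exact: base0.
Qed.

Lemma baseN n x : U n x -> U n (- x).
Proof. by rewrite -scaleN1r; apply: (base_balanced hU); rewrite normrN1. Qed.

Lemma base_sub n x y : U n.+1 x -> U n.+1 y -> U n (x - y).
Proof. by move=> Ux /baseN Uy; exact: (base_add hU). Qed.

Lemma base_subC n x y : U n (x - y) -> U n (y - x).
Proof. by move=> /baseN; rewrite opprB. Qed.

Lemma base_scale_le n (c : K) : exists m, forall (a : K) x,
  `|a| <= `|c| -> U m x -> U n (a *: x).
Proof.
have [->|c0] := eqVneq c 0.
  exists 0%N => a x; rewrite normr0 normr_le0 => /eqP-> _.
  by rewrite scale0r; exact: base0.
have [m h] := base_scale hU n c; exists m => a x ac /h Ux.
rewrite -[a](divfK c0) -scalerA; apply: (base_balanced hU) => //.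
by rewrite normrM normfV ler_pdivrMr ?mul1r ?normr_gt0.
Qed.

(** Peel off the first term: it lies in [U n.+1], and by induction so does the
    rest, whose indices start one step further. *)
Lemma base_sum n m N (u : nat -> X) (A : pred nat) :
  (forall i, (m <= i)%N -> (i < N)%N -> U (n + (i - m)).+1 (u i)) ->
  U n (\sum_(m <= i < N | A i) u i).
Proof.
have [Nm|mN] := leqP N m; first by move=> _; rewrite big_geq //; exact: base0.
rewrite -(subnK (ltnW mN)); move: (N - m)%N => k {mN N}.
elim: k m n => [|k IHk] m n hu; first by rewrite big_geq //; exact: base0.
have h : U n.+1 (\sum_(m.+1 <= i < k.+1 + m | A i) u i).
  rewrite addSnnS; apply: IHk => i mi ik.
  have -> : (n.+1 + (i - m.+1)).+1 = (n + (i - m)).+1 by lia.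
  by apply: hu; [exact: ltnW|rewrite addSnnS].
rewrite big_mkcond big_ltn ?addSn ?ltnS ?leq_addl // -addSn -big_mkcond.
apply: (base_add hU) => //; case: (A m); last exact: base0.
by have := hu m (leqnn m); rewrite subnn addn0 addSn ltnS leq_addl; apply.
Qed.

Lemma base_closure (A : set X) x :
  closure A x <-> forall n, exists2 y, A y & U n (x - y).
Proof.
split=> [cx n|h B /(base_nbhs hU)[n hB]].
  have /cx [y [Ay Uy]] : nbhs x [set y | U n (y - x)].
    by apply/(base_nbhs hU); exists n.
  by exists y => //; exact: base_subC.
by have [y Ay /base_subC Uy] := h n; exists y; split => //; exact: hB.
Qed.

Lemma base_closed (A : set X) x : closed A ->
  (forall n, exists2 y, A y & U n (x - y)) -> A x.
Proof. by move=> cA h; apply: cA; apply/base_closure. Qed.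

Lemma base_cvg (u : nat -> X) x :
  u @ \oo --> x <-> forall n, exists N, forall k, (N <= k)%N -> U n (u k - x).
Proof.
split=> [ux n|h B /(base_nbhs hU)[n hB]].
  have /ux : nbhs x [set y | U n (y - x)] by apply/(base_nbhs hU); exists n.
  by move=> [N _ hN]; exists N => k; exact: hN.
by have [N hN] := h n; exists N => // k /= /hN; exact: hB.
Qed.

End Base.

(** Dropping the first neighbourhoods of a base makes it possible to assume
    that a property of some [U n] already holds for [U 0]. *)
Lemma balanced_base_shift (K : numFieldType) (X : topologicalLmodType K)
    (U : nat -> set X) n0 :
  balanced_base U -> balanced_base (fun n => U (n0 + n)%N).
Proof.
move=> hU; split.
- by move=> n; exact: (base_balanced hU).
- by move=> n x y; rewrite addnS; exact: (base_add hU).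
- move=> x Ux; apply: (base_separates hU) => n.
  by apply: (base_le hU) (Ux n); exact: leq_addl.
- move=> n c; have [m hm] := base_scale hU (n0 + n)%N c.
  by exists m => x Ux; apply: hm; apply: (base_le hU) Ux; exact: leq_addl.
- by move=> n; exact: (base_absorb hU).
- move=> x A; rewrite (base_nbhs hU); split=> -[n hn]; last by exists (n0 + n)%N.
  by exists n => y Uy; apply: hn; apply: (base_le hU) Uy; exact: leq_addl.
Qed.

Section BaseExists.
Variables (K : numFieldType) (X : topologicalLmodType K).
Implicit Types A : set X.

Lemma nbhs_translate x A : nbhs x A <-> nbhs 0 [set h | A (x + h)].
Proof.
have tr y : continuous (fun h : X => y + h).
  move=> h; apply: (@continuous_comp _ (X * X)%type _ (fun h => (y, h))
    (fun z => z.1 + z.2)); last exact: add_continuous.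
  by apply: cvg_pair => /=; [exact: cvg_cst|exact: cvg_id].
split=> [xA|hA]; first by have := tr x 0 A; rewrite addr0 => /(_ xA).
have := tr (- x) x [set h | A (x + h)]; rewrite addNr => /(_ hA).
rewrite /nbhs /=; apply: filterS => y /=.
by rewrite addrA subrr add0r.
Qed.

Lemma nbhs0_scale (c : K) A : nbhs 0 A -> nbhs 0 [set x | A (c *: x)].
Proof.
move=> hA; have := @scale_continuous K X (c, 0) A; rewrite /= scaler0.
move=> /(_ hA)[[B1 B2] /= [B10 B20] hB]; apply: filterS B20 => x Bx.
by apply: (hB (c, x)); split => //; exact: nbhs_singleton.
Qed.

Lemma nbhs0_absorb x A : nbhs 0 A ->
  exists2 e : K, 0 < e & forall c, `|c| <= e -> A (c *: x).
Proof.
move=> hA; have := @scale_continuous K X (0, x) A; rewrite /= scale0r.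
move=> /(_ hA)[[B1 B2] /= [/nbhs_ballP[e /= e0 eB] Bx] hB].
exists (e / 2); first by rewrite divr_gt0.
move=> c ce; apply: (hB (c, x)); split => /=; last exact: nbhs_singleton.
apply: eB; rewrite -ball_normE /= sub0r normrN (le_lt_trans ce) //.
by rewrite ltr_pdivrMr // mulr2n mulrDr mulr1 ltrDl.
Qed.

(** Continuity of the addition gives the halving; continuity of the scaling at
    [(0, 0)] then allows one to pass to the balanced set of all [a *: x] with
    [a] small and [x] in a small neighbourhood. *)
Lemma nbhs0_half A : nbhs 0 A -> exists V : set X,
  [/\ nbhs 0 V, forall (a : K) x, `|a| <= 1 -> V x -> V (a *: x) &
      forall x y, V x -> V y -> A (x + y)].
Proof.
move=> hA; have := @add_continuous X (0, 0) A; rewrite /= addr0.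
move=> /(_ hA)[[B1 B2] /= [B10 B20] hB].
have := @scale_continuous K X (0, 0) (B1 `&` B2); rewrite /= scaler0.
move=> /(_ (filterI B10 B20))[[C1 C2] /= [/nbhs_ballP[e /= e0 eC] C20] hC].
exists [set y | exists a x, [/\ `|a| < e, C2 x & y = a *: x]]; split.
- have e20 : 0 < e / 2 by rewrite divr_gt0.
  apply: filterS (nbhs0_scale (e / 2)^-1 C20) => y Cy.
  exists (e / 2), ((e / 2)^-1 *: y); split => //; last first.
    by rewrite scalerA mulfV ?scale1r ?gt_eqF.
  rewrite gtr0_norm // ltr_pdivrMr // mulr2n mulrDr mulr1 ltrDl //.
- move=> a _ a1 [b [x [be Cx ->]]]; exists (a * b), x; split => //.
    by rewrite normrM (le_lt_trans _ be) // ler_piMl.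
  by rewrite scalerA.
- have h a x : `|a| < e -> C2 x -> (B1 `&` B2) (a *: x).
    move=> ae Cx; apply: (hC (a, x)); split => //=; apply: eC.
    by rewrite -ball_normE /= sub0r normrN.
  move=> _ _ [a [x [ae Cx ->]]] [b [y [be Cy ->]]].
  by apply: (hB (_, _)); split => /=; [case: (h a x)|case: (h b y)].
Qed.

(** The metric serves only to provide countably many neighbourhoods of [0] that
    form a base; halving and intersecting them in turn gives [U]. *)
Lemma metrizable_base (R : realType) : metrizable R X ->
  exists U : nat -> set X, balanced_base U.
Proof.
move=> [d [d0 dC dT dN]].
pose B k := [set y : X | d 0 y < k.+1%:R^-1].
have B_nbhs k : nbhs 0 (B k).
  by rewrite dN; exists k.+1%:R^-1 => //=; rewrite invr_gt0.
have d_ge0 x y : 0 <= d x y.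
  have := dT x y x; rewrite (d0 x x).2 // (dC y x) -mulr2n.
  by rewrite pmulrn_lge0.
have arch (e : R) : 0 < e -> exists k, k.+1%:R^-1 < e.
  move=> e0; exists (Num.trunc e^-1); rewrite invf_plt ?posrE //.
  by rewrite truncnS_gt.
have B_base A : nbhs 0 A -> exists k, B k `<=` A.
  rewrite dN => -[e /= e0 hA]; have [k ke] := arch _ e0; exists k => y /= By.
  by apply: hA => /=; exact: lt_trans ke.
have /choice[f hf] : forall A : set X, exists V : set X, nbhs 0 A ->
    [/\ nbhs 0 V, forall (a : K) x, `|a| <= 1 -> V x -> V (a *: x) &
      forall x y, V x -> V y -> A (x + y)].
  move=> A; have [/nbhs0_half[V hV]|nA] := pselect (nbhs 0 A); first by exists V.
  by exists setT.
pose U := fix U k := if k is k'.+1 then f (U k' `&` B k') else f setT.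
have U_nbhs k : nbhs 0 (U k).
  elim: k => [|k IHk] /=; first by case: (hf setT filterT).
  by case: (hf _ (filterI IHk (B_nbhs k))).
have U_bal k (a : K) x : `|a| <= 1 -> U k x -> U k (a *: x).
  case: k => [|k] /=; first by case: (hf setT filterT) => _ + _; exact.
  by case: (hf _ (filterI (U_nbhs k) (B_nbhs k))) => _ + _; exact.
have U_add k x y : U k.+1 x -> U k.+1 y -> (U k `&` B k) (x + y).
  by case: (hf _ (filterI (U_nbhs k) (B_nbhs k))) => _ _; exact.
have U0 k : U k 0 by exact: nbhs_singleton.
have U_base A : nbhs 0 A -> exists k, U k `<=` A.
  move=> /B_base[k kA]; exists k.+1 => x Ux; apply: kA.
  by have := U_add k x 0 Ux (U0 _); rewrite addr0 => -[].
exists U; split => //.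
- by move=> n x y Ux Uy; case: (U_add n x y).
- move=> x Ux; apply/esym/d0/eqP; rewrite eq_le d_ge0 andbT leNgt.
  apply/negP => /arch[k]; have := U_add k x 0 (Ux _) (U0 _).
  by rewrite addr0 => -[_ /= h] /(lt_trans h); rewrite ltxx.
- move=> n c; have [m hm] := U_base _ (nbhs0_scale c (U_nbhs n)).
  by exists m => x /hm.
- by move=> n x; exact: nbhs0_absorb.
- move=> x A; rewrite nbhs_translate; split=> [/U_base[n hn]|[n hn]].
    by exists n => y /hn /=; rewrite addrC subrK.
  by apply: filterS (U_nbhs n) => h Uh; apply: hn; rewrite addrAC subrr add0r.
Qed.

End BaseExists.

(** * Linear algebra over a subring of the scalars *)

Section Submodules.
Variables (K : numFieldType) (X : lmodType K).
Implicit Types (F : set K) (V W Z : set X).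

Record subring_set F : Prop := {
  subring1 : F 1;
  subringB : forall a b, F a -> F b -> F (a - b);
  subringM : forall a b, F a -> F b -> F (a * b) }.

Lemma subringT : subring_set setT. Proof. by []. Qed.

Lemma subring0 F : subring_set F -> F 0.
Proof. by move=> hF; rewrite -(subrr 1); apply: subringB => //; exact: subring1. Qed.

Lemma subringN F a : subring_set F -> F a -> F (- a).
Proof. by move=> hF Fa; rewrite -sub0r; apply: subringB => //; exact: subring0. Qed.

(** With [F = setT] these are the linear subspaces. A countable dense [F] makes
    the submodule generated by a sequence countable while its closure remains a
    linear subspace. *)
Definition submodule F Z :=
  Z 0 /\ forall a x y, F a -> Z x -> Z y -> Z (a *: x + y).

Lemma submoduleZ F Z a x : submodule F Z -> F a -> Z x -> Z (a *: x).
Proof. by move=> [Z0 hZ] Fa Zx; rewrite -[_ *: _]addr0; exact: hZ. Qed.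

Lemma submoduleD F Z x y : subring_set F -> submodule F Z ->
  Z x -> Z y -> Z (x + y).
Proof.
move=> hF [Z0 hZ] Zx Zy; rewrite -[x]scale1r; apply: hZ => //; exact: subring1.
Qed.

Lemma submoduleN F Z x : subring_set F -> submodule F Z -> Z x -> Z (- x).
Proof.
move=> hF hZ Zx; rewrite -scaleN1r; apply: (submoduleZ hZ) => //.
by apply: (subringN hF); exact: subring1.
Qed.

Lemma submoduleB F Z x y : subring_set F -> submodule F Z ->
  Z x -> Z y -> Z (x - y).
Proof.
by move=> hF hZ Zx Zy; apply: (submoduleD hF) => //; exact: (submoduleN hF).
Qed.

Lemma submodule_sum F Z m N (A : pred nat) (a : nat -> K) (y : nat -> X) :
  submodule F Z -> (forall i, F (a i)) ->
  (forall i, (m <= i)%N -> (i < N)%N -> Z (y i)) ->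
  Z (\sum_(m <= i < N | A i) a i *: y i).
Proof.
move=> [Z0 hZ] Fa Zy; rewrite big_seq_cond; elim/big_rec: _ => // i x.
by rewrite mem_index_iota => /andP[/andP[mi iN] _] Zx; apply: hZ => //; exact: Zy.
Qed.

Lemma submoduleI F V Z : submodule F V -> submodule F Z -> submodule F (V `&` Z).
Proof.
move=> [V0 hV] [Z0 hZ]; split=> // a x y Fa [Vx Zx] [Vy Zy].
by split; [exact: hV|exact: hZ].
Qed.

(** The sum [F x + Z]; iterated over a list [s], it is the sum of [Z] and of the
    submodule generated by [s]. *)
Definition addline F (x : X) Z :=
  [set w | exists a z, [/\ F a, Z z & w = a *: x + z]].

Lemma submodule_addline F x Z : subring_set F -> submodule F Z ->
  submodule F (addline F x Z).
Proof.
move=> hF hZ; split.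
  exists 0, 0; split; [exact: subring0|by case: hZ|by rewrite scale0r addr0].
move=> a _ _ Fa [b [u [Fb Zu ->]]] [c [v [Fc Zv ->]]].
exists (a * b + c), (a *: u + v); split.
- by rewrite -[c]opprK; apply: (subringB hF); [exact: subringM|exact: subringN].
- by case: hZ => _; apply.
- by rewrite scalerDr scalerA scalerDl addrACA.
Qed.

Lemma sub_addline F x Z : subring_set F -> Z `<=` addline F x Z.
Proof.
move=> hF z Zz; exists 0, z; split => //; first exact: subring0.
by rewrite scale0r add0r.
Qed.

Definition addlines F (s : seq X) Z := foldr (addline F) Z s.

Lemma submodule_addlines F s Z : subring_set F -> submodule F Z ->
  submodule F (addlines F s Z).
Proof. by move=> hF hZ; elim: s => //= x s; exact: submodule_addline. Qed.

Lemma sub_addlines F s Z : subring_set F -> Z `<=` addlines F s Z.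
Proof.
by move=> hF; elim: s => //= x s IHs; apply: subset_trans IHs (sub_addline _ _).
Qed.

Lemma addlinesS F s Z1 Z2 : Z1 `<=` Z2 -> addlines F s Z1 `<=` addlines F s Z2.
Proof.
move=> Z12; elim: s => //= x s IHs _ [a [z [Fa Zz ->]]].
by exists a, z; split => //; exact: IHs.
Qed.

Lemma addlines_sub F s Z V : subring_set F -> submodule F V -> Z `<=` V ->
  (forall x, x \in s -> V x) -> addlines F s Z `<=` V.
Proof.
move=> hF hV ZV; elim: s => //= x s IHs sV _ [a [z [Fa Zz ->]]].
case: (hV) => _; apply => //; first by apply: sV; rewrite mem_head.
by apply: IHs Zz => u us; apply: sV; rewrite inE us orbT.
Qed.

(** The terms before the [k]-th one, the latest first: the shape in which
    [seq_choice] builds sequences. *)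
Fixpoint past (T : Type) (y : nat -> T) k :=
  if k is k'.+1 then y k' :: past y k' else [::].

Lemma size_past T (y : nat -> T) k : size (past y k) = k.
Proof. by elim: k => //= k ->. Qed.

Lemma mem_addlines F (s : seq X) Z x : subring_set F -> submodule F Z ->
  x \in s -> addlines F s Z x.
Proof.
move=> hF hZ; elim: s => //= v s IHs; rewrite inE => /orP[/eqP->|/IHs].
  exists 1, 0; split; [exact: subring1| |by rewrite scale1r addr0].
  by case: (submodule_addlines s hF hZ).
exact: sub_addline.
Qed.

Lemma mem_past (T : eqType) (y : nat -> T) i k : (i < k)%N -> y i \in past y k.
Proof.
elim: k => //= k IHk; rewrite ltnS leq_eqVlt inE => /orP[/eqP->|/IHk->].
  by rewrite eqxx.
by rewrite orbT.
Qed.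

Lemma addlines_past F y k a z Z : (forall i, F (a i)) -> Z z ->
  addlines F (past y k) Z (\sum_(0 <= i < k) a i *: y i + z).
Proof.
move=> Fa Zz; elim: k => [|k IHk] /=; first by rewrite big_geq // add0r.
exists (a k), (\sum_(0 <= i < k) a i *: y i + z); split => //.
by rewrite big_nat_recr //= [in LHS]addrAC addrC.
Qed.

(** Independence is over the whole field, whatever the subring [F]. *)
Definition independent (y : nat -> X) := forall N (a : nat -> K),
  \sum_(0 <= i < N) a i *: y i = 0 -> forall i, (i < N)%N -> a i = 0.

(** Infinite dimension of the generated subspace, in a form that makes sense for
    submodules over any subring. *)
Definition big Z := exists2 y, forall i, Z (y i) & independent y.

Lemma bigS Z1 Z2 : Z1 `<=` Z2 -> big Z1 -> big Z2.
Proof. by move=> Z12 [y Zy iy]; exists y => // i; exact: Z12. Qed.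

Lemma independent_neq0 y : independent y -> forall i, y i <> 0.
Proof.
move=> iy i yi0.
have h : \sum_(0 <= k < i.+1) (k == i)%:R *: y k = 0.
  rewrite big_nat_recr //= yi0 scaler0 addr0 big_nat big1 // => k /andP[_ ki].
  by rewrite ltn_eqF // scale0r.
by have /eqP := iy _ _ h i (ltnSn i); rewrite eqxx oner_eq0.
Qed.

(** Intersecting with a subspace of codimension one does not destroy infinite
    dimension. If [v i = a i *: x + z i] and [a i0 <> 0], the vectors
    [a i0 *: v i - a i *: v i0] lie in [Z], and for [i > i0] they are
    independent. No division is used, so the scalars may form a mere subring. *)
Lemma big_addline F x V Z : subring_set F -> submodule F V -> submodule F Z ->
  V `<=` addline F x Z -> big V -> big (V `&` Z).
Proof.
move=> hF hV hZ VZ [v Vv iv].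
have /choice[a /choice[z haz]] : forall i, exists a z,
    [/\ F a, Z z & v i = a *: x + z] by move=> i; exact: VZ.
have Fa i : F (a i) by case: (haz i).
have Zz i : Z (z i) by case: (haz i).
have vE i : v i = a i *: x + z i by case: (haz i).
have [a0|/existsNP[i0 /eqP ai0]] := pselect (forall i, a i = 0).
  by exists v => // i; split => //; rewrite vE a0 scale0r add0r.
exists (fun i => a i0 *: v (i0.+1 + i)%N - a (i0.+1 + i)%N *: v i0).
  move=> i; split.
    by apply: (submoduleB hF hV); exact: (submoduleZ hV).
  rewrite !vE !scalerDr !scalerA [X in _ *: x + _ - (X *: x + _)]mulrC.
  rewrite opprD addrACA subrr add0r.
  by apply: (submoduleB hF hZ); exact: (submoduleZ hZ).
move=> N b hb i iN.
pose s := \sum_(0 <= i < N) b i * a (i0.+1 + i)%N.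
(* the coefficients of the given relation, expanded along v *)
pose c (k : nat) :=
  if k == i0 then - s else if (k < i0)%N then 0 else b (k - i0.+1)%N * a i0.
have hc : \sum_(0 <= k < i0.+1 + N) c k *: v k = 0.
  rewrite (@big_cat_nat _ _ _ i0.+1) //= ?leq_addr // big_nat_recr //=.
  rewrite big_nat big1 => [|k /andP[_ ki]]; last first.
    by rewrite /c ltn_eqF // ki scale0r.
  rewrite add0r /c eqxx -[X in \sum_(X <= _ < _) _]add0n big_addn addKn.
  rewrite -[RHS]hb scaleNr scaler_suml addrC -sumrB; apply: eq_bigr => k _.
  rewrite scalerBr !scalerA; congr (_ *: _ - _); last by rewrite addnC.
  rewrite addnK.
  have h : (i0 < k + i0.+1)%N by rewrite addnS ltnS leq_addl.
  by rewrite gtn_eqF // ltnNge (ltnW h).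
have := iv _ _ hc (i0.+1 + i)%N; rewrite ltn_add2l iN => /(_ isT) /eqP.
have h : (i0 < i0.+1 + i)%N by rewrite addSn ltnS leq_addr.
rewrite /c gtn_eqF // [(_ < i0)%N]ltnNge (ltnW h) /=.
by rewrite addKn mulf_eq0 (negbTE ai0) orbF => /eqP.
Qed.

Lemma big_addlines F s V Z : subring_set F -> submodule F V -> submodule F Z ->
  V `<=` addlines F s Z -> big V -> big (V `&` Z).
Proof.
move=> hF hV hZ; elim: s V hV => [|x s IHs] V hV VZ bV /=.
  by apply: bigS bV => x Vx; split => //; exact: VZ.
have hs := submodule_addlines s hF hZ.
have : big ((V `&` addlines F s Z) `&` Z).
  apply: IHs; [exact: submoduleI|by move=> u []|exact: (@big_addline F x)].
by apply: bigS => u [[]].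
Qed.

Definition seq_span F (y : nat -> X) :=
  [set x | exists N a, (forall i, F (a i)) /\ x = \sum_(0 <= i < N) a i *: y i].

Lemma span_sub F y Z : submodule F Z -> (forall i, Z (y i)) -> seq_span F y `<=` Z.
Proof.
by move=> hZ Zy _ [N [a [Fa ->]]]; apply: (submodule_sum _ hZ) => // i _ _.
Qed.

Lemma mem_span F y i : subring_set F -> seq_span F y (y i).
Proof.
move=> hF; exists i.+1, (fun k => (k == i)%:R); split.
  by move=> k; case: eqP => _; [exact: subring1|exact: subring0].
rewrite big_nat_recr //= eqxx scale1r big_nat big1 ?add0r // => k /andP[_ ki].
by rewrite ltn_eqF // scale0r.
Qed.

Lemma sum_extend N M (a : nat -> K) (y : nat -> X) : (N <= M)%N ->
  \sum_(0 <= i < N) a i *: y i =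
  \sum_(0 <= i < M) (if (i < N)%N then a i else 0) *: y i.
Proof.
move=> NM; rewrite (@big_cat_nat _ _ _ N 0 M) //=.
rewrite [X in _ = _ + X]big_nat [X in _ = _ + X]big1 ?addr0.
  by apply: eq_big_nat => i /andP[_ ->].
by move=> i /andP[]; rewrite leqNgt => /negbTE-> _; rewrite scale0r.
Qed.

Lemma submodule_span F y : subring_set F -> submodule F (seq_span F y).
Proof.
move=> hF; split.
  by exists 0%N, (fun=> 0); split; [move=> _; exact: subring0|rewrite big_geq].
move=> c _ _ Fc [N [a [Fa ->]]] [M [b [Fb ->]]].
pose t (L : nat) (e : nat -> K) i := if (i < L)%N then e i else 0.
have Ft L e : (forall i, F (e i)) -> forall i, F (t L e i).
  by move=> Fe i; rewrite /t; case: ifP => // _; exact: subring0.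
exists (maxn N M), (fun i => c * t N a i + t M b i); split.
  move=> i; rewrite -[t M b i]opprK; apply: (subringB hF).
    by apply: (subringM hF) => //; exact: Ft.
  by apply: subringN => //; exact: Ft.
rewrite (sum_extend a y (leq_maxl N M)) (sum_extend b y (leq_maxr N M)).
rewrite scaler_sumr -big_split /=; apply: eq_bigr => i _.
by rewrite scalerDl scalerA.
Qed.

Lemma big_span F y : subring_set F -> independent y -> big (seq_span F y).
Proof. by move=> hF iy; exists y => // i; exact: mem_span. Qed.

(** Otherwise the intersection with [0] of the span of [Z] would be infinite
    dimensional, by [big_addlines]. *)
Lemma big_avoids Z s : big Z -> exists2 x, Z x & ~ addlines setT s [set 0] x.
Proof.
move=> [y Zy iy]; apply: contrapT => /forall2NP h.
have h0 : submodule setT [set 0 : X].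
  by split=> // a u v _ -> ->; rewrite scaler0 addr0.
have hs := submodule_addlines s subringT h0.
have [z z0 iz] : big (seq_span setT y `&` [set 0]).
  apply: (@big_addlines setT s) => //; first exact: submodule_span.
    by apply: span_sub => // i; have [//|/contrapT] := h (y i).
  exact: big_span.
by apply: (independent_neq0 iz (i := 0%N)); case: (z0 0%N).
Qed.

Lemma independent_past (y : nat -> X) :
  (forall k, ~ addlines setT (past y k) [set 0] (y k)) -> independent y.
Proof.
move=> hy; elim=> // N IHN a; rewrite big_nat_recr //= => hs i.
have aN : a N = 0.
  apply: contrapT => /eqP aN; apply: (hy N).
  have -> : y N = \sum_(0 <= i < N) (- (a N)^-1 * a i) *: y i + 0.
    apply: (scalerI aN); move/eqP: hs; rewrite addrC addr_eq0 => /eqP->.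
    rewrite addr0 scaler_sumr -sumrN; apply: eq_bigr => k _.
    by rewrite scalerA mulrA mulrN mulfV // mulN1r scaleNr.
  by apply: addlines_past.
rewrite ltnS leq_eqVlt => /orP[/eqP->//|]; apply: IHN.
by rewrite -[RHS]hs aN scale0r addr0.
Qed.

End Submodules.

(** * Closed subspaces and dimension *)

Definition cauchy_complete (K : numFieldType) := forall a : nat -> K,
  (forall e, 0 < e -> exists N, forall i j, (N <= i)%N -> (N <= j)%N ->
     `|a i - a j| < e) ->
  exists l, forall e, 0 < e -> exists N, forall i, (N <= i)%N -> `|a i - l| < e.

Lemma norm_ltP (K : numFieldType) (a c : K) : 0 < c -> `|a| < c \/ c <= `|a|.
Proof.
by move=> c0; case: (real_ltP (normr_real a) (gtr0_real c0)); [left|right].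
Qed.

(** Dependent choice in which each new term may depend on all the previous
    ones. *)
Lemma seq_choice (T : Type) (P : seq T -> Prop) : P [::] ->
  (forall s, P s -> exists x, P (x :: s)) ->
  exists y : nat -> T, forall k, P (past y k).
Proof.
move=> P0 PS.
have [x0 _] := PS _ P0.
have /choice[f hf] : forall s, exists x, P s -> P (x :: s).
  move=> s; have [Ps|nPs] := pselect (P s); last by exists x0.
  by have [x Px] := PS s Ps; exists x.
pose s := fix s k := if k is k'.+1 then f (s k') :: s k' else [::].
have E k : past (fun k => f (s k)) k = s k by elim: k => //= k ->.
by exists (fun k => f (s k)); elim=> [//|k IHk]; rewrite E /=; apply: hf; rewrite -E.
Qed.

Section Closure.
Variables (K : numFieldType) (X : topologicalLmodType K) (U : nat -> set X).
Hypothesis hU : balanced_base U.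
Implicit Types (V W Z : set X).

Lemma submodule_closure Z : submodule setT Z -> submodule setT (closure Z).
Proof.
move=> hZ; split; first by apply: subset_closure; case: hZ.
move=> a x y _ /(base_closure hU) hx /(base_closure hU) hy.
apply/(base_closure hU) => n.
have [m hm] := base_scale hU n.+1 a.
have [x' Zx' Ux'] := hx m; have [y' Zy' Uy'] := hy n.+1.
exists (a *: x' + y'); first by case: hZ => _; exact.
by rewrite opprD addrACA -scalerBr; apply: (base_add hU) => //; exact: hm.
Qed.

(** Say that [x] is not in [Z]: then [(x + U n) `&` Z] is empty for some [n],
    and balancedness gives [`|c| < 1] as soon as [c *: x + z] is in [U n] for
    some [z] in [Z]. By scaling, the coefficients of [x] in a Cauchy sequence of
    the sum form a Cauchy sequence of scalars. *)
Lemma closed_addline (x : X) Z : cauchy_complete K -> submodule setT Z -> closed Z ->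
  closed (addline setT x Z).
Proof.
move=> hK hZ cZ; have [Zx|Zx] := pselect (Z x).
  suff -> : addline setT x Z = Z by [].
  apply/seteqP; split=> [_ [a [z [_ Zz ->]]]|].
    by case: hZ => _; exact.
  exact: (sub_addline _ (subringT K)).
have [n hn] : exists n, forall z, Z z -> ~ U n (x - z).
  apply: contrapT => /forallNP h; apply: Zx; apply: (base_closed hU cZ) => n.
  apply: contrapT => h'; apply: (h n) => z Zz Uz; apply: h'; by exists z.
have bnd c z : Z z -> U n (c *: x + z) -> `|c| < 1.
  move=> Zz Uc; have [//|c1] := norm_ltP c (ltr01 : 0 < 1 :> K).
  have c0 : c != 0 by rewrite -normr_gt0 (lt_le_trans ltr01).
  case: (hn (- (c^-1 *: z))).
    by apply: (submoduleN (subringT K) hZ); exact: (submoduleZ hZ).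
  rewrite opprK -[x in x + _](scalerK c0) -scalerDr.
  by apply: (base_balanced hU) => //; rewrite normfV invf_le1 // normr_gt0.
move=> y /(base_closure hU) hy.
have /choice[a /choice[z haz]] : forall k, exists a z, Z z /\ U k (y - (a *: x + z)).
  by move=> k; have [_ [a [z [_ Zz ->]]] Uk] := hy k; exists a, z.
have [e e0|l hl] := hK a.
  have [m hm] := base_scale hU n e^-1; exists m.+1 => i j mi mj.
  have [Zi Ui] := haz i; have [Zj Uj] := haz j.
  have : `|e^-1 * (a i - a j)| < 1.
    apply: (bnd _ (e^-1 *: (z i - z j))).
      by apply: (submoduleZ hZ) => //; exact: (submoduleB (subringT K) hZ).
    rewrite -scalerA -scalerDr; apply: hm.
    have -> : (a i - a j) *: x + (z i - z j) =
        (y - (a j *: x + z j)) - (y - (a i *: x + z i)).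
      by rewrite opprB [RHS]addrC [RHS]addrA subrK opprD [RHS]addrACA -scalerBl.
    by apply: (base_sub hU); [exact: base_le Uj|exact: base_le Ui].
  by rewrite normrM gtr0_norm ?invr_gt0 // mulrC ltr_pdivrMr // mul1r.
exists l, (y - l *: x); split => //; last by rewrite addrC subrK.
apply: (base_closed hU cZ) => k.
have [e e0 he] := base_absorb hU k.+1 x; have [N hN] := hl e e0.
pose i := maxn N k.+1; have [Zi Ui] := haz i.
exists (z i) => //.
have -> : y - l *: x - z i = (y - (a i *: x + z i)) + (a i - l) *: x.
  by rewrite scalerBl opprD [y + (_ + _)]addrA [RHS]addrACA subrK [RHS]addrA addrAC.
apply: (base_add hU); first by apply: base_le Ui => //; exact: leq_maxr.
by apply: he; apply: ltW; apply: hN; exact: leq_maxl.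
Qed.

Lemma closed_addlines s Z : cauchy_complete K -> submodule setT Z -> closed Z ->
  closed (addlines setT s Z).
Proof.
move=> hK hZ cZ; elim: s => //= x s IHs; apply: closed_addline => //.
exact: (submodule_addlines _ (subringT K)).
Qed.

End Closure.

Section Dimension.
Variables (K : numFieldType) (X : topologicalLmodType K).
Implicit Types (A V : set X).

Lemma linear_subspaceE V : linear_subspace V <-> submodule setT V.
Proof. by split=> -[V0 hV]; split => // a x y; [move=> _|]; exact: hV. Qed.

Lemma submodule_lin_span A : submodule setT (lin_span A).
Proof.
split; first by exists 0%N, (fun=> 0), (fun=> 0); split; [case|rewrite big_ord0].
move=> c _ _ _ [n [v [a [Av ->]]]] [m [w [b [Aw ->]]]].
exists (n + m)%N, (fun i => match fintype.split i with inl j => v j | inr j => w j end).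
exists (fun i => match fintype.split i with inl j => c * a j | inr j => b j end).
split=> [i|]; first by case: fintype.splitP.
rewrite big_split_ord /= scaler_sumr; congr (_ + _); apply: eq_bigr => i _.
  by rewrite (unsplitK (inl i)) scalerA.
by rewrite (unsplitK (inr i)).
Qed.

Lemma mem_lin_span A x : A x -> lin_span A x.
Proof.
move=> Ax; exists 1%N, (fun=> x), (fun=> 1); split => //.
by rewrite big_ord_recl big_ord0 scale1r addr0.
Qed.

Lemma lin_span_sub A V : submodule setT V -> A `<=` V -> lin_span A `<=` V.
Proof.
move=> [V0 hV] AV _ [n [v [a [Av ->]]]].
by elim/big_rec: _ => // i x _ Vx; apply: hV => //; exact: AV.
Qed.

Lemma lin_span_range (e : nat -> X) : lin_span (range e) = seq_span setT e.
Proof.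
apply/seteqP; split.
  apply: lin_span_sub; first exact: (submodule_span _ (subringT K)).
  by move=> _ [i _ <-]; exact: (mem_span _ _ (subringT K)).
by apply: span_sub => [|i]; [exact: submodule_lin_span|apply: mem_lin_span; exists i].
Qed.

Lemma submodule0 : submodule setT [set 0 : X].
Proof. by split=> // a x y _ -> ->; rewrite scaler0 addr0. Qed.

(** Choose the vectors one by one outside of the span of the previous ones. *)
Lemma infinite_dim_big V : linear_subspace V -> infinite_dim V -> big V.
Proof.
move=> /linear_subspaceE hV iV.
have [|s [sV _]|y hy] := @seq_choice X (fun s => (forall x, x \in s -> V x) /\
    if s is x :: s' then ~ addlines setT s' [set 0] x else True).
- by [].
- apply: contrapT => /forallNP h; apply: iV.
  exists [set` s]; first exact: finite_seq.
  apply/seteqP; split; last exact: lin_span_sub.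
  move=> x Vx; have : addlines setT s [set 0] x.
    apply: contrapT => nx; apply: (h x); split => // u.
    by rewrite inE => /orP[/eqP->|/sV].
  apply: addlines_sub => //; first exact: submodule_lin_span.
    by move=> _ ->; case: (submodule_lin_span [set` s]).
  by move=> u us; exact: mem_lin_span.
exists y; last by apply: independent_past => k; case: (hy k.+1).
by move=> i; case: (hy i.+1) => + _; apply; rewrite /= mem_head.
Qed.

Lemma big_infinite_dim V : big V -> infinite_dim V.
Proof.
move=> bV [A /finite_seqP[s ->] VE].
have [x Vx] := big_avoids s bV; apply.
move: Vx; rewrite VE; apply: lin_span_sub => [|u us].
  exact: (submodule_addlines _ (subringT K) submodule0).
exact: (mem_addlines (subringT K) submodule0).
Qed.

End Dimension.

(** * Suppressible sequences are unconditional bases *)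

Section Unconditional.
Variables (K : numFieldType) (X : topologicalLmodType K) (U : nat -> set X).
Hypothesis hU : balanced_base U.

Lemma base_coef_lt1 n (x : X) (a : K) : ~ U n x -> U n (a *: x) -> `|a| < 1.
Proof.
move=> nUx Uax; have [//|a1] := norm_ltP a (ltr01 : 0 < 1 :> K).
have a0 : a != 0 by rewrite -normr_gt0 (lt_le_trans ltr01).
case: nUx; rewrite -[x](scalerK a0); apply: (base_balanced hU) => //.
by rewrite normfV invf_le1 // normr_gt0.
Qed.

Lemma base_neq0 (x : X) : x <> 0 -> exists n, ~ U n x.
Proof. by move=> x0; apply/existsNP => /(base_separates hU). Qed.

Lemma lt_all_eq0 (c : K) : (forall d, 0 < d -> `|c| < d) -> c = 0.
Proof.
move=> h; apply: contrapT => /eqP; rewrite -normr_gt0 => /h.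
by rewrite ltxx.
Qed.

(** The partial sums of the expansions along [e] are mapped to their subsums
    equicontinuously. *)
Definition suppressible (e : nat -> X) := forall n, exists m,
  forall N (a : nat -> K) (A : pred nat), U m (\sum_(0 <= i < N) a i *: e i) ->
    U n (\sum_(0 <= i < N | A i) a i *: e i).

Section Suppressible.
Variable e : nat -> X.
Hypotheses (hK : cauchy_complete K) (he : suppressible e) (e0 : forall i, e i <> 0).

(** Suppress all the terms but the [i]-th, which lies then in a neighbourhood
    that does not contain [e i]. *)
Lemma suppressible_coef i (d : K) : 0 < d -> exists m, forall N a, (i < N)%N ->
  U m (\sum_(0 <= k < N) a k *: e k) -> `|a i| < d.
Proof.
move=> d0; have [n hn] := base_neq0 (e0 (i := i)); have [m hm] := he n.
have [m' hm'] := base_scale hU m d^-1; exists m' => N a iN /hm'.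
rewrite scaler_sumr; under eq_bigr do rewrite scalerA.
move=> /(hm _ (fun k => d^-1 * a k) (pred1 i)).
rewrite big_nat1_eq /= iN => /(base_coef_lt1 hn).
by rewrite normrM gtr0_norm ?invr_gt0 // mulrC ltr_pdivrMr // mul1r.
Qed.

Lemma sum_coef_small n M (b : nat -> nat -> K) :
  (forall i d, 0 < d -> exists L, forall l, (L <= l)%N -> `|b l i| < d) ->
  exists L, forall l (A : pred nat), (L <= l)%N ->
    U n (\sum_(0 <= i < M | A i) b l i *: e i).
Proof.
move=> hb; elim: M n => [|M IHM] n.
  by exists 0%N => l A _; rewrite big_geq //; exact: base0.
have [L hL] := IHM n.+1; have [d d0 hd] := base_absorb hU n.+1 (e M).
have [L' hL'] := hb M d d0; exists (maxn L L') => l A.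
rewrite geq_max => /andP[Ll L'l]; rewrite big_mkcond big_nat_recr //= -big_mkcond.
apply: (base_add hU); first exact: hL.
by case: (A M); [apply: hd; apply: ltW; exact: hL'|exact: base0].
Qed.

Lemma sum_trunc N M (A : pred nat) (a : nat -> K) :
  (forall i, (N <= i)%N -> a i = 0) -> (N <= M)%N -> (forall i, (i < N)%N -> A i) ->
  \sum_(0 <= i < M | A i) a i *: e i = \sum_(0 <= i < N) a i *: e i.
Proof.
move=> a0 NM hA; rewrite big_mkcond (@big_cat_nat _ _ _ N 0 M) //=.
rewrite [X in _ + X]big_nat [X in _ + X]big1 ?addr0.
  by apply: eq_big_nat => i /andP[_ iN]; rewrite hA.
by move=> i /andP[Ni _]; rewrite a0 // scale0r; case: ifP.
Qed.

(** Let finite sums [\sum b k i *: e i] converge to [x] as [k] grows. Each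
    coefficient is Cauchy in [k], with limit [a i]. Suppressibility bounds all
    the subsums of the difference of two approximations [k] and [l] at once;
    letting [l] grow with [k] fixed, it bounds the subsums of
    [\sum (b k i - a i) *: e i], uniformly in the set [A] of indices. This
    gives convergence along the net of finite sets, hence for every order of
    summation. *)
Lemma suppressible_expansion x : closure (seq_span setT e) x ->
  exists a : nat -> K, forall n, exists N, forall M (A : pred nat),
    (N <= M)%N -> (forall i, (i < N)%N -> A i) ->
    U n (x - \sum_(0 <= i < M | A i) a i *: e i).
Proof.
move=> /(base_closure hU) hx.
have /choice[N /choice[b hb]] : forall k, exists N b,
    (forall i, (N <= i)%N -> b i = 0 :> K) /\
    U k (x - \sum_(0 <= i < N) b i *: e i).
  move=> k; have [_ [N [b [_ ->]]] Uk] := hx k.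
  exists N, (fun i => if (i < N)%N then b i else 0); split.
    by move=> i; rewrite ltnNge => ->.
  by rewrite -sum_extend.
have b0 k i : (N k <= i)%N -> b k i = 0 by case: (hb k) => + _; exact.
have bU k M : (N k <= M)%N -> U k (x - \sum_(0 <= i < M) b k i *: e i).
  move=> NM; rewrite (@sum_trunc (N k) M predT) //; first by case: (hb k).
  exact: b0.
have diff m k l M : (m < k)%N -> (m < l)%N -> (N k <= M)%N -> (N l <= M)%N ->
    U m (\sum_(0 <= i < M) (b k i - b l i) *: e i).
  move=> mk ml kM lM.
  under eq_bigr do rewrite scalerBl.
  have sub2 (p q : X) : p - q = (x - q) - (x - p).
    by rewrite opprB [RHS]addrC [RHS]addrA subrK.
  rewrite sumrB sub2.
  by apply: (base_sub hU); [exact: base_le (bU l _ lM)|exact: base_le (bU k _ kM)].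
have /choice[a ha] : forall i, exists a, forall d, 0 < d ->
    exists L, forall l, (L <= l)%N -> `|b l i - a| < d.
  move=> i; apply: (hK (a := fun l => b l i)) => d d0.
  have [m hm] := suppressible_coef i d0; exists m.+1 => k l mk ml.
  apply: (hm (maxn i.+1 (maxn (N k) (N l))) (fun i => b k i - b l i)).
    exact: leq_maxl.
  by apply: diff => //; rewrite !leq_max leqnn ?orbT.
(* one half of U n for the error on x, one quarter for each of the differences
   between b k, b l and a *)
exists a => n; have [m hm] := he n.+2; pose k := maxn m.+1 n.+1.
exists (N k) => M A kM hA.
have [L hL] : exists L, forall l (A : pred nat), (L <= l)%N ->
    U n.+2 (\sum_(0 <= i < M | A i) (b l i - a i) *: e i).
  by apply: sum_coef_small => i d d0; exact: ha.
pose l := maxn L m.+1.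
have h1 : U n.+2 (\sum_(0 <= i < M | A i) (b k i - b l i) *: e i).
  have := hm _ _ (fun i => A i && (i < M)%N)
    (@diff m k l (maxn M (N l)) _ _ _ _).
  rewrite (@big_cat_nat _ _ _ M 0) ?leq_maxl //= addrC big_nat_cond big1 => [|i].
    rewrite add0r big_nat_cond [in X in _ -> X]big_nat_cond.
    under eq_bigl do rewrite andbC -andbA (andbC (_ < _)%N).
    under eq_bigl do rewrite -andbA andbb andbC.
    by apply; rewrite ?leq_maxl ?leq_maxr // leq_max kM.
  by rewrite leqNgt => /andP[/andP[/negbTE->]]; rewrite andbF.
have h2 := hL l A (leq_maxl _ _).
have h3 : U n.+1 (x - \sum_(0 <= i < M | A i) b k i *: e i).
  rewrite (sum_trunc (b0 k)) //; apply: base_le (_ : U k _) => //.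
    exact: leq_maxr.
  by case: (hb k).
have -> : x - \sum_(0 <= i < M | A i) a i *: e i =
  (x - \sum_(0 <= i < M | A i) b k i *: e i) +
  (\sum_(0 <= i < M | A i) (b k i - b l i) *: e i +
   \sum_(0 <= i < M | A i) (b l i - a i) *: e i).
  rewrite -big_split /=; under [X in _ = _ + X]eq_bigr do
    rewrite -scalerDl addrA subrK scalerBl.
  by rewrite sumrB addrA subrK.
by apply: (base_add hU) => //; exact: (base_add hU).
Qed.

Lemma expansion_unique (a b : nat -> K) (x : X) :
  series (fun i => a i *: e i) @ \oo --> x ->
  series (fun i => b i *: e i) @ \oo --> x -> a = b.
Proof.
move=> /(base_cvg hU) ax /(base_cvg hU) bx; apply/funext => i.
apply/eqP; rewrite -subr_eq0; apply/eqP; apply: lt_all_eq0 => d d0.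
have [m hm] := suppressible_coef i d0.
have [N1 h1] := ax m.+1; have [N2 h2] := bx m.+1.
pose M := maxn i.+1 (maxn N1 N2).
apply: (hm M (fun i => a i - b i)); first exact: leq_maxl.
have E : \sum_(0 <= k < M) (a k - b k) *: e k =
  (series (fun i => a i *: e i) M - x) - (series (fun i => b i *: e i) M - x).
  rewrite opprB addrA subrK /series /= -sumrB.
  by apply: eq_bigr => k _; rewrite scalerBl.
by rewrite E; apply: (base_sub hU); [apply: h1|apply: h2];
  rewrite !leq_max leqnn ?orbT.
Qed.

(** A partial sum of a rearranged series is a subsum of the original one. *)
Lemma sum_injective (u : nat -> X) (s : nat -> nat) M M' : injective s ->
  (forall k, (k < M)%N -> (s k < M')%N) ->
  \sum_(0 <= k < M) u (s k) =
  \sum_(0 <= j < M' | j \in map s (index_iota 0 M)) u j.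
Proof.
move=> si sM; rewrite -(big_map s predT u) /= -[RHS]big_filter.
apply: perm_big; apply: uniq_perm.
- by rewrite map_inj_uniq // iota_uniq.
- by rewrite filter_uniq // iota_uniq.
move=> j; rewrite mem_filter mem_index_iota; case: mapP => //= -[k].
by rewrite mem_index_iota => /andP[_ kM] ->; rewrite sM.
Qed.

Lemma ex_bound (f : nat -> nat) N : exists M, forall k, (k < N)%N -> (f k < M)%N.
Proof.
elim: N => [|N [M hM]]; first by exists 0%N.
exists (maxn M (f N).+1) => k; rewrite ltnS leq_eqVlt => /orP[/eqP->|/hM kM].
  by rewrite leq_maxr.
by rewrite (leq_trans kM) // leq_maxl.
Qed.

Lemma suppressible_unconditional : unconditional_basic_sequence e.
Proof.
rewrite /unconditional_basic_sequence /closed_span lin_span_range.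
have expand x (a : nat -> K) : (forall n, exists N, forall M (A : pred nat),
    (N <= M)%N -> (forall i, (i < N)%N -> A i) ->
    U n (x - \sum_(0 <= i < M | A i) a i *: e i)) ->
    series (fun i => a i *: e i) @ \oo --> x.
  move=> ha; apply/(base_cvg hU) => n; have [N hN] := ha n; exists N => M NM.
  by apply: (base_subC hU); exact: (hN M predT).
split; first split.
- by move=> n; apply: subset_closure; exact: (mem_span _ _ (subringT K)).
- move=> x /suppressible_expansion[a ha]; exists a; split; first exact: expand.
  by move=> b; apply: expansion_unique; exact: expand.
move=> x a /suppressible_expansion[b hb] ax s [t st ts].
have -> : a = b by apply: expansion_unique ax _; exact: expand.
apply/(base_cvg hU) => n; have [N hN] := hb n.
have [L hL] := ex_bound t N; exists L => M LM.
have [M' hM'] := ex_bound s M.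
apply: (base_subC hU); rewrite /series /=.
rewrite (@sum_injective (fun i => b i *: e i) s M (maxn M' N) (can_inj st)).
  apply: hN; first exact: leq_maxr.
  move=> i iN; apply/mapP; exists (t i); last by rewrite ts.
  by rewrite mem_index_iota /=; apply: leq_trans LM; exact: hL.
by move=> k /hM' kM; rewrite leq_max kM.
Qed.

End Suppressible.

End Unconditional.

(** * A criterion for suppressibility, and spaces with short lines *)

Section Criterion.
Variables (K : numFieldType) (X : topologicalLmodType K) (U : nat -> set X).
Hypothesis hU : balanced_base U.
Implicit Types e : nat -> X.

(** The [i]-th coefficient functional is continuous on the span of [e]; the
    neighbourhood may depend on [i]. *)
Definition bounded_coef e i := exists p, exists2 c : K, 0 < c & forall N a,
  (i < N)%N -> U p (\sum_(0 <= k < N) a k *: e k) -> `|a i| < c.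

(** Suppressibility for the neighbourhood [U n] alone, and only along a tail of
    the sequence that may depend on [n]. *)
Definition tail_suppressible e n := exists j m, forall N a (A : pred nat),
  U m (\sum_(j <= k < N) a k *: e k) -> U n (\sum_(j <= k < N | A k) a k *: e k).

Lemma bounded_coef_neq0 e i : bounded_coef e i -> e i <> 0.
Proof.
move=> [p [c c0 hp]] ei0; have := hp i.+1 (fun k => (k == i)%:R * c) (ltnSn i).
rewrite eqxx mul1r gtr0_norm // ltxx => h; suff : false by [].
apply: h; rewrite big_nat_recr //= ei0 scaler0 addr0.
rewrite big_nat big1; first exact: base0.
by move=> k /andP[_ ki]; rewrite ltn_eqF // mul0r scale0r.
Qed.

(** A bounded linear functional becomes small on a smaller neighbourhood; this
    applies to the finitely many coefficients of the head. *)
Lemma head_small e j q : (forall i, (i < j)%N -> bounded_coef e i) ->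
  exists m, forall N a (A : pred nat), (j <= N)%N ->
    U m (\sum_(0 <= k < N) a k *: e k) -> U q (\sum_(0 <= k < j | A k) a k *: e k).
Proof.
elim: j q => [|j IHj] q hj.
  by exists 0%N => N a A _ _; rewrite big_geq //; exact: base0.
have [m hm] : exists m, forall N a (A : pred nat), (j <= N)%N ->
    U m (\sum_(0 <= k < N) a k *: e k) -> U q.+1 (\sum_(0 <= k < j | A k) a k *: e k).
  by apply: IHj => i ij; apply: hj; exact: ltnW.
have [p [c c0 hp]] := hj j (ltnSn j).
have [d d0 hd] := base_absorb hU q.+1 (e j).
have [p' hp'] := base_scale hU p (c / d).
exists (maxn m p') => N a A jN Us.
rewrite big_mkcond big_nat_recr //= -big_mkcond; apply: (base_add hU).
  by apply: (hm N); [exact: ltnW|apply: base_le Us => //; exact: leq_maxl].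
case: (A j); last exact: base0.
have /hp' : U p' (\sum_(0 <= k < N) a k *: e k).
  by apply: base_le Us => //; exact: leq_maxr.
rewrite scaler_sumr; under eq_bigr do rewrite scalerA.
move=> /(hp _ (fun k => c / d * a k) jN).
rewrite normrM gtr0_norm ?divr_gt0 // mulrAC -mulrA gtr_pMr // ltr_pdivrMr // mul1r.
by move=> /ltW; exact: hd.
Qed.

(** On a small neighbourhood the first [j] terms are all negligible, so both
    the head and the tail of a subsum are under control. *)
Lemma suppressible_of_tail e : (forall i, bounded_coef e i) ->
  (forall n, tail_suppressible e n) -> suppressible U e.
Proof.
move=> he ht n; have [j [m0 hm0]] := ht n.+1.
have [m1 hm1] := head_small (maxn n.+1 m0.+1) (fun i (_ : (i < j)%N) => he i).
exists (maxn m1 m0.+1) => N a A Us.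
pose b k := if (k < N)%N then a k else 0.
have aE (B : pred nat) :
    \sum_(0 <= k < N | B k) a k *: e k = \sum_(0 <= k < N + j | B k) b k *: e k.
  rewrite big_mkcond [RHS]big_mkcond /= [RHS](@big_cat_nat _ _ _ N) ?leq_addr //=.
  rewrite [X in _ = _ + X]big_nat [X in _ = _ + X]big1 ?addr0.
    by apply: eq_big_nat => k /andP[_ kN]; rewrite /b kN.
  by move=> k /andP[]; rewrite leqNgt /b => /negbTE->; rewrite scale0r if_same.
have {}Us : U (maxn m1 m0.+1) (\sum_(0 <= k < N + j) b k *: e k).
  by rewrite -(aE predT).
have hh B : U (maxn n.+1 m0.+1) (\sum_(0 <= k < j | B k) b k *: e k).
  apply: (hm1 (N + j)%N); first exact: leq_addl.
  by apply: base_le Us => //; exact: leq_maxl.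
rewrite aE big_mkcond (@big_cat_nat _ _ _ j) ?leq_addl //= -!big_mkcond.
apply: (base_add hU).
  by apply: base_le (hh _) => //; exact: leq_maxl.
apply: hm0.
have -> : \sum_(j <= k < N + j) b k *: e k =
    \sum_(0 <= k < N + j) b k *: e k - \sum_(0 <= k < j) b k *: e k.
  by rewrite (@big_cat_nat _ _ _ j 0 (N + j)) ?leq_addl //= [RHS]addrAC subrr add0r.
apply: (base_sub hU); first by apply: base_le Us => //; exact: leq_maxr.
by apply: base_le (hh predT) => //; exact: leq_maxr.
Qed.

(** The span of the [e i] is then a copy of a dense subspace of the space of all
    scalar sequences. The next line is chosen inside a neighbourhood much
    smaller than one that misses the current vector: whatever its coefficients,
    a tail is negligible, so that the coefficients are continuous one after the
    other. *)
Lemma short_lines_unconditional : cauchy_complete K ->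
  (forall n, exists2 x : X, x <> 0 & forall c, U n (c *: x)) ->
  exists e : nat -> X, unconditional_basic_sequence e.
Proof.
move=> hK hx.
pose level (s : seq (X * nat)) := if s is p :: _ then p.2 else 0%N.
have [//|s _|y hy] := @seq_choice (X * nat) (fun s => if s is p :: s' then
  [/\ ~ U p.2 p.1, (level s' < p.2)%N & forall c, U (level s').+2 (c *: p.1)]
  else True).
  have [x x0 xU] := hx (level s).+2; have [n hn] := base_neq0 hU x0.
  (* the levels must increase for the tails to be summable *)
  exists (x, maxn n (level s).+1); split => //=; last exact: leq_maxr.
  by move=> Ux; apply: hn; apply: base_le Ux => //; exact: leq_maxl.
pose e i := (y i).1; pose l i := (y i).2.
have el i : ~ U (l i) (e i) by case: (hy i.+1).
have lS i : (l i < l i.+1)%N by case: (hy i.+2).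
have eU i c : U (l i).+2 (c *: e i.+1) by case: (hy i.+2).
have lD i k : (l i + k <= l (i + k))%N.
  elim: k => [|k IHk]; first by rewrite !addn0.
  by rewrite !addnS; apply: leq_ltn_trans IHk (lS _).
have tail i N a (A : pred nat) : U (l i).+1 (\sum_(i.+1 <= k < N | A k) a k *: e k).
  apply: base_sum => // -[//|k]; rewrite ltnS subSS => ik _.
  apply: base_le (eU k _) => //; rewrite addSn !ltnS.
  by have := lD i (k - i)%N; rewrite subnKC.
have li i : (i <= l i)%N by rewrite (leq_trans _ (lD 0%N i)) // leq_addl.
have he i : bounded_coef e i.
  elim/ltn_ind: i => i IHi.
  have [m hm] := head_small (l i).+2 IHi.
  exists (maxn m (l i).+2), 1 => // N a iN Us.
  apply: (base_coef_lt1 hU (el i)).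
  have -> : a i *: e i = (\sum_(0 <= k < N) a k *: e k - \sum_(0 <= k < i) a k *: e k)
     - \sum_(i.+1 <= k < N) a k *: e k.
    rewrite (@big_cat_nat _ _ _ i 0 N) //= ?(ltnW iN) // (big_ltn iN).
    by rewrite [X in X - _]addrAC subrr add0r addrK.
  apply: (base_sub hU); last exact: (tail i N a predT).
  apply: (base_sub hU); first by apply: base_le Us => //; exact: leq_maxr.
  apply: (hm N a predT); first exact: ltnW.
  by apply: base_le Us => //; exact: leq_maxl.
exists e; apply: (suppressible_unconditional hU hK).
  apply: suppressible_of_tail => // n; exists n.+1, 0%N => N a A _.
  by apply: base_le (tail n N a A) => //; exact: leqW.
by move=> i; exact: bounded_coef_neq0.
Qed.

End Criterion.

(** * Fusion of decreasing sequences of subspaces *)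

Section Fusion.
Variables (K : numFieldType) (X : lmodType K).
Implicit Types (Z V : set X) (C : set X -> Prop).

(** The last clause is what is left of the inclusion of [Zo] in [Z k] when it
    only holds up to finitely many dimensions. *)
Definition fusion C := forall Z : nat -> set X, (forall k, C (Z k)) ->
  (forall k, Z k.+1 `<=` Z k) ->
  exists Zo, [/\ C Zo, Zo `<=` Z 0%N &
    forall k V, C V -> V `<=` Zo -> C (V `&` Z k)].

(** [R] will be a quantitative form of separation. *)
Definition contains_pair C (R : set X -> set X -> Prop) Z := exists V W,
  [/\ C V, C W, V `<=` Z, W `<=` Z & R V W].

Lemma contains_pairS C R Z Z' : Z `<=` Z' ->
  contains_pair C R Z -> contains_pair C R Z'.
Proof.
move=> ZZ' [V [W [CV CW VZ WZ VW]]]; exists V, W; split => //.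
  exact: subset_trans ZZ'.
exact: subset_trans ZZ'.
Qed.

(** For each [k] in turn, pass to a subspace that contains no pair in [R k] if
    there is one; otherwise every subspace contains such a pair already. A
    fusion of the resulting sequence settles all [k] at once, since [R k] is
    hereditary and the fusion meets every stage in a member of [C]. *)
Lemma fusion_stabilize C (R : nat -> set X -> set X -> Prop) :
  fusion C ->
  (forall k V W V' W', R k V W -> V' `<=` V -> W' `<=` W -> R k V' W') ->
  forall Z0, C Z0 -> exists Z, [/\ C Z, Z `<=` Z0 &
    forall k, contains_pair C (R k) Z ->
      forall Z', C Z' -> Z' `<=` Z -> contains_pair C (R k) Z'].
Proof.
move=> fC hR Z0 CZ0.
pose stable k Z := contains_pair C (R k) Z ->
  forall Z', C Z' -> Z' `<=` Z -> contains_pair C (R k) Z'.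
have /choice[f0 hf0] : forall kZ : nat * set X, exists Z', C kZ.2 ->
    [/\ C Z', Z' `<=` kZ.2 & stable kZ.1 Z'].
  move=> [k Z] /=.
  have [[Z' [CZ' Z'Z nZ']]|nex] := pselect (exists Z',
      [/\ C Z', Z' `<=` Z & ~ contains_pair C (R k) Z']).
    by exists Z' => _; split => // /nZ'.
  exists Z => CZ; split => // _ Z' CZ' Z'Z; apply: contrapT => nZ'.
  by apply: nex; exists Z'.
pose f k Z := f0 (k, Z).
have hf k Z : C Z -> [/\ C (f k Z), f k Z `<=` Z & stable k (f k Z)].
  exact: (hf0 (k, Z)).
pose Z := fix Z k := if k is k'.+1 then f k' (Z k') else Z0.
have CZ k : C (Z k) by elim: k => //= k IHk; case: (hf k _ IHk).
have dZ k : Z k.+1 `<=` Z k by case: (hf k _ (CZ k)).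
have [Zo [CZo ZoZ hZo]] := fC Z CZ dZ.
exists Zo; split => // k [V [W [CV CW VZ WZ VW]]] Z' CZ' Z'Zo.
have [_ _ st] := hf k _ (CZ k).
suff : contains_pair C (R k) (Z' `&` Z k.+1).
  by apply: contains_pairS => x [].
apply: st; last by move=> x [].
- exists (V `&` Z k.+1), (W `&` Z k.+1); split.
  + exact: hZo.
  + exact: hZo.
  + by move=> x [].
  + by move=> x [].
  + by apply: hR VW _ _ => x [].
- exact: hZo.
Qed.

(** The [k]-th vector is taken in [Z k], so that all but finitely many of them
    lie in a given [Z k]. *)
Lemma diagonal_sequence (Z : nat -> set X) : (forall k, big (Z k)) ->
  (forall k, Z k.+1 `<=` Z k) -> exists y : nat -> X, independent y /\
  forall F k, subring_set F -> submodule F (Z k) ->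
    seq_span F y `<=` addlines F (past y k) (Z k).
Proof.
move=> bZ dZ.
have [//|s _|y hy] := @seq_choice X (fun s => if s is x :: s' then
    Z (size s') x /\ ~ addlines setT s' [set 0] x else True).
  by have [x Zx hx] := big_avoids s (bZ (size s)); exists x.
have yZ i : Z i (y i) by case: (hy i.+1); rewrite size_past.
have ZZ i k : (i <= k)%N -> Z k `<=` Z i.
  elim: k => [|k IHk]; first by rewrite leqn0 => /eqP->.
  rewrite leq_eqVlt => /orP[/eqP->//|]; rewrite ltnS => /IHk.
  exact: subset_trans.
exists y; split; first by apply: independent_past => k; case: (hy k.+1).
move=> F k hF hZ; apply: span_sub; first exact: submodule_addlines.
move=> i; have [ki|ik] := leqP k i.
  by apply: sub_addlines => //; exact: ZZ (yZ i).
by apply: mem_addlines => //; exact: mem_past.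
Qed.

Lemma fusion_submodule (F : set K) (D : set X) : subring_set F ->
  fusion (fun Z => [/\ submodule F Z, big Z & Z `<=` D]).
Proof.
move=> hF Z CZ dZ.
have [|y [iy hy]] := @diagonal_sequence Z _ dZ; first by move=> k; case: (CZ k).
have hZ k : submodule F (Z k) by case: (CZ k).
exists (seq_span F y); split.
- split; [exact: submodule_span|exact: big_span|].
  by apply: subset_trans (hy F 0%N hF (hZ _)) _; case: (CZ 0%N).
- exact: (hy F 0%N).
- move=> k V [hV bV VD] Vy; split; first exact: submoduleI.
    apply: (@big_addlines _ _ F (past y k)) => //.
    by apply: subset_trans Vy _; exact: hy.
  by move=> x [/VD].
Qed.

End Fusion.

(** * Separated pairs of subspaces *)

Definition closed_space (K : numFieldType) (X : topologicalLmodType K) (Z : set X) :=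
  [/\ submodule setT Z, closed Z & big Z].

Section Split.
Variables (K : numFieldType) (X : topologicalLmodType K) (U : nat -> set X).
Hypothesis hU : balanced_base U.
Hypothesis hK : cauchy_complete K.
Implicit Types (V W Z : set X).

Lemma closed_space_span (y : nat -> X) : independent y ->
  closed_space (closure (seq_span setT y)).
Proof.
move=> iy; split; [|exact: closed_closure|].
  by apply: (submodule_closure hU); exact: (submodule_span _ (subringT K)).
apply: bigS (@subset_closure _ _) _.
exact: (big_span (subringT K)).
Qed.

(** The closed span of a diagonal sequence works because the sum of [Z k] and
    finitely many lines is closed. *)
Lemma fusion_closed_space : fusion (@closed_space K X).
Proof.
move=> Z CZ dZ.
have [|y [iy hy]] := @diagonal_sequence _ _ Z _ dZ; first by move=> k; case: (CZ k).
have hZ k : submodule setT (Z k) by case: (CZ k).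
have cy k : closure (seq_span setT y) `<=` addlines setT (past y k) (Z k).
  rewrite closureE => x; apply; split; last exact: (hy _ _ (subringT K)).
  by case: (CZ k) => _ cZk _; exact: (closed_addlines hU).
exists (closure (seq_span setT y)); split; first exact: closed_space_span.
  exact: (cy 0%N).
move=> k V [hV cV bV] Vy; split; first exact: submoduleI.
  by apply: closedI => //; case: (CZ k).
apply: (@big_addlines _ _ setT (past y k)) => //.
by apply: subset_trans Vy _.
Qed.

(** Quantitative separation: [V] and [W] are separated when for every [n] there
    is [m] with [sep m n V W]. *)
Definition sep m n V W := forall v w, V v -> W w -> U m (v + w) -> U n v /\ U n w.

Lemma sepS m n V W V' W' : sep m n V W -> V' `<=` V -> W' `<=` W -> sep m n V' W'.
Proof. by move=> VW V'V W'W v w /V'V Vv /W'W Ww; exact: VW. Qed.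

(** Continuity at [0] of the projection onto [V], and then of the one onto [W],
    which is the difference with the identity. *)
Lemma separated_sep V W : V 0 -> W 0 -> separated_subspaces V W ->
  forall n, exists m, sep m n V W.
Proof.
move=> V0 W0 [_ [p [pV cp]]] n.
have p0 : p 0 = 0 by rewrite -[X in p X]addr0 pV.
have VW0 : [set v + w | v in V & w in W] 0.
  by exists 0 => //; exists 0 => //; rewrite addr0.
have nU : nbhs (p 0) (U n.+1).
  by rewrite p0; apply/(base_nbhs hU); exists n.+1 => y; rewrite subr0.
have /(base_nbhs hU)[m hm] : nbhs 0 [set x |
    [set v + w | v in V & w in W] x -> U n.+1 (p x)].
  by move/subspace_continuousP: cp => /(_ 0 VW0 _ nU).
exists (maxn m n.+1) => v w Vv Ww Uvw.
have Uv : U n.+1 v.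
  rewrite -(pV v w) //; apply: hm; last by exists v => //; exists w.
  by rewrite subr0; apply: base_le Uvw => //; exact: leq_maxl.
split; first by apply: base_le Uv => //; exact: leqnSn.
rewrite -[w](addKr v) addrC; apply: (base_sub hU) => //.
by apply: base_le Uvw => //; exact: leq_maxr.
Qed.

End Split.

(** * Sequences whose coefficients are bounded on a fixed neighbourhood *)

Section Perturbation.
Variables (K : numFieldType) (X : topologicalLmodType K) (U : nat -> set X).
Hypothesis hU : balanced_base U.
Implicit Types (V W Z : set X).

(** The coefficients along [u] are bounded on one common neighbourhood [U p].
    As [U p] need not be a bounded set, this is more than the continuity of each
    coefficient, and it is what makes [u] stable under perturbation. *)
Definition regular p (C : nat -> K) (u : nat -> X) := (forall i, 0 < C i) /\
  forall N a, U p (\sum_(0 <= i < N) a i *: u i) ->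
    forall i, (i < N)%N -> `|a i| < C i.

Lemma head_absorb q i (c : K) (v : nat -> X) : 0 < c ->
  exists2 s : K, 1 <= s & forall a, (forall j, (j < i)%N -> `|a j| < c) ->
    U q (s^-1 *: \sum_(0 <= j < i) a j *: v j).
Proof.
move=> c0; elim: i q => [|i IHi] q.
  by exists 1 => // a _; rewrite big_geq // scaler0; exact: base0.
have [s1 s11 h1] := IHi q.+1; have [d d0 hd] := base_absorb hU q.+1 (v i).
have s10 : 0 < s1 by rewrite (lt_le_trans ltr01).
have cd : 0 < c / d by rewrite divr_gt0.
have s0 : 0 < s1 + c / d by rewrite addr_gt0.
exists (s1 + c / d) => [|a ha]; first by rewrite (le_trans s11) // lerDl ltW.
rewrite big_nat_recr //= scalerDr; apply: (base_add hU).
  set S := \sum_(0 <= j < i) _.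
  have -> : (s1 + c / d)^-1 *: S = ((s1 + c / d)^-1 * s1) *: (s1^-1 *: S).
    by rewrite -scalerA scalerKV // gt_eqF.
  apply: (base_balanced hU); last by apply: h1 => j ji; apply: ha; exact: ltnW.
  rewrite normrM normfV (gtr0_norm s0) (gtr0_norm s10) mulrC ler_pdivrMr // mul1r lerDl.
  exact: ltW.
rewrite scalerA; apply: hd; rewrite normrM normfV (gtr0_norm s0) mulrC.
rewrite ler_pdivrMr // mulrDr mulrCA divff ?gt_eqF // mulr1 (le_trans (ltW (ha i _))) //.
by rewrite lerDr mulr_ge0 // ltW.
Qed.

Lemma argmax (f : nat -> K) N : (forall i, 0 <= f i) -> (0 < N)%N ->
  exists2 i, (i < N)%N & forall j, (j < N)%N -> f j <= f i.
Proof.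
move=> f0; elim: N => // -[_ _|N /(_ isT)[i iN hi] _].
  by exists 0%N => // -[].
have [le_iN|/ltW lt_Ni] := real_leP (ger0_real (f0 i)) (ger0_real (f0 N.+1)).
  exists N.+1 => // j; rewrite ltnS leq_eqVlt => /orP[/eqP->//|/hi h].
  exact: le_trans le_iN.
exists i; first exact: leqW.
by move=> j; rewrite ltnS leq_eqVlt => /orP[/eqP->|/hi].
Qed.

(** Scale by the inverse of the largest value. *)
Lemma rescale (f : nat -> K) N : (forall i, 0 <= f i) ->
  (forall i, (i < N)%N -> f i < 1) \/
  exists s, [/\ 0 < s <= 1, forall i, (i < N)%N -> s * f i <= 1 &
    exists2 i, (i < N)%N & s * f i = 1].
Proof.
move=> f0; have [|N0] := leqP N 0; first by rewrite leqn0 => /eqP->; left.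
have [i iN hi] := argmax f0 N0.
have [lt1|ge1] := real_ltP (ger0_real (f0 i)) (real1 K).
  by left=> j /hi /le_lt_trans; apply.
have fi0 : 0 < f i by rewrite (lt_le_trans ltr01).
right; exists (f i)^-1; split.
- by rewrite invr_gt0 fi0 invf_le1.
- by move=> j /hi h; rewrite mulrC ler_pdivrMr // mul1r.
- by exists i => //; rewrite mulVf // gt_eqF.
Qed.

(** As long as the coefficients of a combination of the [v' i] and [w' i] are
    within the bounds [C] and [B], it differs by little from the corresponding
    combination of the [v i] and [w i], so that separation of [V] and [W]
    applies, and regularity makes the bounds strict. Coefficients beyond the
    bounds are excluded by scaling them down until the largest one reaches its
    bound exactly, which contradicts strictness. *)
Lemma perturb p (C B : nat -> K) (v w v' w' : nat -> X) V W q r n :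
  regular p C v -> regular p B w -> (p <= r)%N -> (n < r)%N ->
  submodule setT V -> submodule setT W -> (forall i, V (v i)) -> (forall i, W (w i)) ->
  sep U q r V W ->
  (forall i a, `|a| <= C i -> U (maxn q.+2 n.+1 + i).+1 (a *: (v' i - v i))) ->
  (forall i a, `|a| <= B i -> U (maxn q.+2 n.+1 + i).+1 (a *: (w' i - w i))) ->
  forall N a b, let sv := \sum_(0 <= i < N) a i *: v' i in
    let sw := \sum_(0 <= i < N) b i *: w' i in U q.+1 (sv + sw) ->
    (forall i, (i < N)%N -> `|a i| < C i /\ `|b i| < B i) /\ (U n sv /\ U n sw).
Proof.
move=> [C0 hC] [B0 hB] pr nr hV hW Vv Ww VW hv' hw' N.
have core a b : (forall i, (i < N)%N -> `|a i| <= C i /\ `|b i| <= B i) ->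
    U q.+1 (\sum_(0 <= i < N) a i *: v' i + \sum_(0 <= i < N) b i *: w' i) ->
    (forall i, (i < N)%N -> `|a i| < C i /\ `|b i| < B i) /\
    (U n (\sum_(0 <= i < N) a i *: v' i) /\ U n (\sum_(0 <= i < N) b i *: w' i)).
  move=> hab Us.
  pose da := \sum_(0 <= i < N) a i *: (v' i - v i).
  pose db := \sum_(0 <= i < N) b i *: (w' i - w i).
  have Uda : U (maxn q.+2 n.+1) da.
    by apply: base_sum => // i _ /hab[ai _]; rewrite subn0; exact: hv'.
  have Udb : U (maxn q.+2 n.+1) db.
    by apply: base_sum => // i _ /hab[_ bi]; rewrite subn0; exact: hw'.
  have Ev : \sum_(0 <= i < N) a i *: v' i = \sum_(0 <= i < N) a i *: v i + da.
    by rewrite -big_split /=; apply: eq_bigr => i _; rewrite -scalerDr addrC subrK.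
  have Ew : \sum_(0 <= i < N) b i *: w' i = \sum_(0 <= i < N) b i *: w i + db.
    by rewrite -big_split /=; apply: eq_bigr => i _; rewrite -scalerDr addrC subrK.
  have [] : U r (\sum_(0 <= i < N) a i *: v i) /\ U r (\sum_(0 <= i < N) b i *: w i).
    apply: VW.
    - by apply: (submodule_sum _ hV) => // i _ _.
    - by apply: (submodule_sum _ hW) => // i _ _.
    have -> : \sum_(0 <= i < N) a i *: v i + \sum_(0 <= i < N) b i *: w i =
      \sum_(0 <= i < N) a i *: v' i + \sum_(0 <= i < N) b i *: w' i - (da + db).
      by rewrite Ev Ew addrACA addrK.
    apply: (base_sub hU) => //; apply: (base_add hU).
      by apply: base_le Uda => //; exact: leq_maxl.
    by apply: base_le Udb => //; exact: leq_maxl.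
  move=> Urv Urw; split=> [i iN|].
    split; first by apply: (hC N a) => //; exact: base_le Urv.
    by apply: (hB N b) => //; exact: base_le Urw.
  rewrite Ev Ew; split; apply: (base_add hU).
  - exact: base_le Urv.
  - by apply: base_le Uda => //; exact: leq_maxr.
  - exact: base_le Urw.
  - by apply: base_le Udb => //; exact: leq_maxr.
move=> a b sv sw Us.
(* both families of ratios at once, so as to scale by the largest of all *)
pose f k := if (k < N)%N then `|a k| / C k else `|b (k - N)%N| / B (k - N)%N.
have f0 k : 0 <= f k by rewrite /f; case: ifP => _; rewrite divr_ge0 // ltW.
have fa i : (i < N)%N -> f i = `|a i| / C i by rewrite /f => ->.
have fb i : f (N + i)%N = `|b i| / B i by rewrite /f ltnNge leq_addr /= addKn.
have [f1|[s [/andP[s0 s1] fle [k kN fk]]]] := rescale (N + N) f0.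
  apply: core => // i iN; split; apply: ltW.
    have := f1 i (leq_trans iN (leq_addl _ _)).
    by rewrite fa // ltr_pdivrMr // mul1r.
  have := f1 (N + i)%N; rewrite ltn_add2l => /(_ iN).
  by rewrite fb ltr_pdivrMr // mul1r.
have [] := core (fun i => s * a i) (fun i => s * b i).
- move=> i iN; rewrite !normrM (gtr0_norm s0); split.
    have := fle i (leq_trans iN (leq_addl _ _)).
    by rewrite fa // mulrA ler_pdivrMr // mul1r.
  have := fle (N + i)%N; rewrite ltn_add2l => /(_ iN).
  by rewrite fb mulrA ler_pdivrMr // mul1r.
- have -> : \sum_(0 <= i < N) (s * a i) *: v' i + \sum_(0 <= i < N) (s * b i) *: w' i
      = s *: (sv + sw).
    by rewrite scalerDr !scaler_sumr; congr (_ + _); apply: eq_bigr => i _;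
      rewrite scalerA.
  by apply: (base_balanced hU) => //; rewrite gtr0_norm.
move=> h _; exfalso; have [lt_kN|le_Nk] := ltnP k N.
  have [+ _] := h k lt_kN; rewrite normrM (gtr0_norm s0).
  by move: fk; rewrite fa // mulrA => /(divr1_eq)->; rewrite ltxx.
have kE : k = (N + (k - N))%N by rewrite subnKC.
have kNN : (k - N < N)%N by rewrite -(ltn_add2l N) -kE.
have [_ +] := h _ kNN.
rewrite normrM (gtr0_norm s0).
by move: fk; rewrite kE fb mulrA addKn => /(divr1_eq)->; rewrite ltxx.
Qed.

End Perturbation.

Section Regular.
Variables (K : numFieldType) (X : topologicalLmodType K) (U : nat -> set X).
Hypothesis hU : balanced_base U.
Implicit Types (V W Z : set X).
Hypothesis no_line : forall x : X, x <> 0 -> exists c : K, ~ U 0 (c *: x).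

(** Split [V] into [S] and [T], take [v 0] in [S] outside of [U 0], split [T],
    and so on. As the pairs are separated with the same [m] all along, a sum in
    [U m] yields [a 0 *: v 0] in [U 0], that is [`|a 0| < 1]. For the next
    coefficients, scale by some [s^-1] that brings the previous terms into
    [U m.+1]; since [U m.+1] is balanced, the whole sum stays there, and
    [s^-1 * a i] is bounded in the same way. *)
Lemma regular_sequence m V :
  (forall Z, closed_space Z -> Z `<=` V ->
     contains_pair (@closed_space K X) (sep U m 0) Z) ->
  closed_space V ->
  exists v C, (forall i, V (v i)) /\ regular U m.+1 C v.
Proof.
move=> hpair cV.
pose space (s : seq (X * set X)) := if s is p :: _ then p.2 else V.
have [|s hs|y hy] := @seq_choice (X * set X) (fun s =>
  [/\ closed_space (space s), space s `<=` V & if s is p :: s' then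
  [/\ p.2 `<=` space s', space s' p.1, ~ U 0 p.1 &
    forall a t, p.2 t -> U m (a *: p.1 + t) -> U 0 (a *: p.1)] else True]).
- by split.
- have [cs sV _] := hs; have [S [T [cS cT Ss Ts ST]]] := hpair _ cs sV.
  have [sS _ [z Sz iz]] := cS.
  have [c Uc] := no_line (independent_neq0 iz (i := 0%N)).
  have Scz : S (c *: z 0%N) by exact: (submoduleZ sS).
  exists (c *: z 0%N, T); split => //=; first exact: subset_trans Ts sV.
  split => //; first exact: Ss.
  move=> a t Tt Ut; have [] // := ST (a *: (c *: z 0%N)) t _ Tt Ut.
  exact: (submoduleZ sS).
pose v i := (y i).1; pose T i := (y i).2.
have cT i : closed_space (T i) by case: (hy i.+1).
have vU i : ~ U 0 (v i) by case: (hy i.+1) => _ _ [].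
have vT i a t : T i t -> U m (a *: v i + t) -> U 0 (a *: v i).
  by case: (hy i.+1) => _ _ [_ _ _]; exact.
have TS i : T i.+1 `<=` T i by case: (hy i.+2) => _ _ [].
have Tv i : T i (v i.+1) by case: (hy i.+2) => _ _ [].
have Tle i k : (i <= k)%N -> T k `<=` T i.
  elim: k => [|k IHk]; first by rewrite leqn0 => /eqP->.
  rewrite leq_eqVlt => /orP[/eqP->//|]; rewrite ltnS => /IHk.
  exact: subset_trans.
have Tlt i k : (i < k)%N -> T i (v k).
  by case: k => // k; rewrite ltnS => ik; exact: Tle (Tv k).
have vV i : V (v i).
  case: i => [|i]; first by case: (hy 1%N) => _ _ [].
  by case: (hy i.+1) => _ + _; apply; exact: Tv.
have bnd i : exists2 c : K, 0 < c & forall N a,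
    U m.+1 (\sum_(0 <= k < N) a k *: v k) ->
    forall j, (j < i)%N -> (j < N)%N -> `|a j| < c.
  elim: i => [|i [c c0 hc]]; first by exists 1.
  have [s s1 hs] := head_absorb hU m.+1 i v c0.
  have s0 : 0 < s by rewrite (lt_le_trans ltr01).
  exists (c + s) => [|N a Us j]; first by rewrite addr_gt0.
  rewrite ltnS leq_eqVlt => /orP[/eqP-> iN|ji jN]; last first.
    by rewrite (lt_trans (hc N a Us j ji jN)) // ltrDl.
  suff : `|s^-1 * a i| < 1.
    rewrite normrM normfV (gtr0_norm s0) mulrC ltr_pdivrMr // mul1r => /lt_trans.
    by apply; rewrite ltrDr.
  apply: (base_coef_lt1 hU (vU i)).
  apply: (vT _ _ (s^-1 *: \sum_(i.+1 <= k < N) a k *: v k)).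
    have [sT _ _] := cT i; apply: (submoduleZ sT) => //.
    by apply: (submodule_sum _ sT) => // k ik _; exact: Tlt.
  have -> : (s^-1 * a i) *: v i + s^-1 *: \sum_(i.+1 <= k < N) a k *: v k =
      s^-1 *: (\sum_(0 <= k < N) a k *: v k) - s^-1 *: (\sum_(0 <= k < i) a k *: v k).
    rewrite -scalerA -scalerDr -scalerBr -(big_ltn iN (F := fun k => a k *: v k)).
    rewrite (@big_cat_nat _ _ _ i 0 N) //= ?(ltnW iN) //.
    by rewrite [X in _ = _ *: X]addrAC subrr add0r.
  apply: (base_sub hU).
    by apply: (base_balanced hU) => //; rewrite normfV gtr0_norm // invf_le1.
  by apply: hs => k ki; apply: (hc N a Us) => //; exact: ltn_trans iN.
have /choice[C hC] : forall i, exists c : K, 0 < c /\ forall N a,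
    U m.+1 (\sum_(0 <= k < N) a k *: v k) -> (i < N)%N -> `|a i| < c.
  move=> i; have [c c0 hc] := bnd i.+1; exists c; split => // N a Us.
  by apply: hc Us _ _.
exists v, C; split => //; split => [i|N a Us i iN]; first by case: (hC i).
by case: (hC i) => _ /(_ N a Us iN).
Qed.

Variable F : set K.
Hypothesis hF : subring_set F.
Hypothesis dF : forall c d : K, 0 < d -> exists2 f, F f & `|c - f| < d.

Lemma closure_dense (y : nat -> X) x k : closure (seq_span setT y) x ->
  exists2 z, seq_span F y z & U k (x - z).
Proof.
move=> /(base_closure hU)/(_ k.+1)[_ [N [b [_ ->]]] Ux].
have /choice[f hf] : forall i, exists f, F f /\ U (k.+1 + i).+1 ((b i - f) *: y i).
  move=> i; have [d d0 hd] := base_absorb hU (k.+1 + i).+1 (y i).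
  by have [f Ff bf] := dF (b i) d0; exists f; split => //; apply: hd; exact: ltW.
exists (\sum_(0 <= i < N) f i *: y i).
  by exists N, f; split => // i; case: (hf i).
rewrite -[X in X - _](subrK (\sum_(0 <= i < N) b i *: y i)) -addrA -sumrB.
apply: (base_add hU) => //; apply: base_sum => // i _ _.
by rewrite -scalerBl subn0; case: (hf i).
Qed.

Lemma regular_independent q (C : nat -> K) (u : nat -> X) :
  regular U q C u -> independent u.
Proof.
move=> [C0 hC] N a s0 i iN; apply: lt_all_eq0 => d d0.
have := hC N (fun k => C i / d * a k).
under eq_bigr do rewrite -scalerA.
rewrite -scaler_sumr s0 scaler0 => /(_ (base0 hU _) i iN).
rewrite normrM gtr0_norm ?divr_gt0 // mulrAC -mulrA gtr_pMr // ltr_pdivrMr //.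
by rewrite mul1r.
Qed.

(** This is where closed subspaces are replaced by submodules. The closure of
    the span of a sequence in [Z] contains two separated closed subspaces, which
    may meet [Z] in [0] only; but regular sequences in them can be approximated
    by sequences in [Z] without losing separation. *)
Lemma split_submodule (Y1 D : set X) m Z n :
  (forall Z, closed_space Z -> Z `<=` Y1 ->
     contains_pair (@closed_space K X) (sep U m 0) Z) ->
  (forall Z, closed_space Z -> Z `<=` Y1 ->
     contains_pair (@closed_space K X)
       (fun V W => forall n, exists m, sep U m n V W) Z) ->
  closed_space Y1 -> Z `<=` Y1 -> Z `<=` D -> submodule F Z -> big Z ->
  exists q, contains_pair (fun V => [/\ submodule F V, big V & V `<=` D])
    (sep U q n) Z.
Proof.
move=> hpair hsplit cY1 ZY1 ZD hZ [y Zy iy].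
have cY := closed_space_span hU iy.
set Y := closure _ in cY.
have YY1 : Y `<=` Y1.
  rewrite /Y closureE => x; apply; have [sY1 cY1' _] := cY1; split => //.
  by apply: span_sub => // i; exact: ZY1.
have [V [W [cV cW VY WY VW]]] := hsplit _ cY YY1.
have hp S : S `<=` Y -> forall Z, closed_space Z -> Z `<=` S ->
   contains_pair (@closed_space K X) (sep U m 0) Z.
  move=> SY T cT TS; apply: hpair => //.
  by apply: subset_trans YY1; exact: subset_trans SY.
have [v [C [Vv rv]]] := regular_sequence (hp _ VY) cV.
have [w [B [Ww rw]]] := regular_sequence (hp _ WY) cW.
(* U r must be inside the neighbourhood of regularity and leave room for n *)
pose r := maxn m.+1 n.+1; have [q hq] := VW r.
have approx (u : nat -> X) (A : nat -> K) : (forall i, Y (u i)) -> (forall i, 0 < A i) ->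
    exists u' : nat -> X, forall i, seq_span F y (u' i) /\
      forall a, `|a| <= A i -> U (maxn q.+2 n.+1 + i).+1 (a *: (u' i - u i)).
  move=> Yu A0; suff /choice[u' hu'] : forall i, exists z, seq_span F y z /\
      forall a, `|a| <= A i -> U (maxn q.+2 n.+1 + i).+1 (a *: (z - u i)).
    by exists u'.
  move=> i.
  have [k hk] := base_scale_le hU (maxn q.+2 n.+1 + i).+1 (A i).
  have [z zy Uz] := closure_dense k (Yu i); exists z; split => // a aA.
  by apply: hk; [rewrite (gtr0_norm (A0 i))|exact: (base_subC hU)].
have [||v' hv'] := approx v C; [by move=> i; exact: VY|by case: rv|].
have [||w' hw'] := approx w B; [by move=> i; exact: WY|by case: rw|].
have [sV _ _] := cV; have [sW _ _] := cW.
have key := perturb hU rv rw (leq_maxl _ _) (leq_maxr _ _ : (n < r)%N) sV sW Vv Ww hq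
  (fun i => (hv' i).2) (fun i => (hw' i).2).
have sum0 N (u : nat -> X) : \sum_(0 <= i < N) (0 : K) *: u i = 0.
  by rewrite big1 // => i _; rewrite scale0r.
have iv' : independent v'.
  apply: (@regular_independent q.+1 C); split; first by case: rv.
  move=> N a Ua i iN; have /= := key N a (fun=> 0).
  by rewrite sum0 addr0 => /(_ Ua)[/(_ i iN)[]].
have iw' : independent w'.
  apply: (@regular_independent q.+1 B); split; first by case: rw.
  move=> N b Ub i iN; have /= := key N (fun=> 0) b.
  by rewrite sum0 add0r => /(_ Ub)[/(_ i iN)[]].
have yZ : seq_span F y `<=` Z by exact: span_sub.
have spanZ u' : (forall i, seq_span F y (u' i)) -> seq_span F u' `<=` Z.
  by move=> hu'; apply: span_sub => // i; exact: yZ.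
have v'Z : seq_span F v' `<=` Z by apply: spanZ => i; case: (hv' i).
have w'Z : seq_span F w' `<=` Z by apply: spanZ => i; case: (hw' i).
exists q.+1, (seq_span F v'), (seq_span F w'); split => //.
- split; [exact: submodule_span|exact: big_span|exact: subset_trans v'Z ZD].
- split; [exact: submodule_span|exact: big_span|exact: subset_trans w'Z ZD].
move=> _ _ [N [a [_ ->]]] [M [b [_ ->]]].
rewrite (sum_extend a v' (leq_maxl N M)) (sum_extend b w' (leq_maxr N M)).
by move=> /key[].
Qed.

End Regular.

Section NoIndecomposable.
Variables (K : numFieldType) (X : topologicalLmodType K) (U : nat -> set X).
Hypothesis hU : balanced_base U.
Hypothesis hK : cauchy_complete K.
Hypothesis no_hi : forall Y : set X, linear_subspace Y -> closed Y ->
  infinite_dim Y -> ~ hereditarily_indecomposable Y.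

Lemma split_closed (Y : set X) : closed_space Y ->
  contains_pair (@closed_space K X)
    (fun V W => forall n, exists m, sep U m n V W) Y.
Proof.
move=> [sY cY bY].
have /contrapT [V [W [[VY WY] [lV cV iV] [lW cW iW] VW]]] :=
  no_hi ((linear_subspaceE _).2 sY) cY (big_infinite_dim bY).
exists V, W; split => //.
- split => //; [exact/linear_subspaceE|exact: infinite_dim_big].
- split => //; [exact/linear_subspaceE|exact: infinite_dim_big].
- by apply: (separated_sep hU) VW; [case: lV|case: lW].
Qed.

(** Stabilize the properties of containing a pair with [sep m 0], for all [m]:
    the resulting space contains such a pair for some [m], hence so does each of
    its closed subspaces, with the same [m]. *)
Lemma uniform_pairs (Y0 : set X) : closed_space Y0 ->
  exists Y m, closed_space Y /\ forall Z, closed_space Z -> Z `<=` Y ->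
    contains_pair (@closed_space K X) (sep U m 0) Z.
Proof.
move=> cY0.
have [|Y [cY _ hY]] := fusion_stabilize (R := fun m => sep U m 0)
  (fusion_closed_space hU hK) _ cY0.
  by move=> k V W V' W'; exact: sepS.
have [V [W [cV cW VY WY /(_ 0%N)[m VW]]]] := split_closed cY.
by exists Y, m; split => //; apply: hY; exists V, W.
Qed.

End NoIndecomposable.

(** * The construction of an unconditional sequence *)

Fixpoint bitseqs k : seq bitseq :=
  if k is k'.+1 then
    [::] :: map (cons true) (bitseqs k') ++ map (cons false) (bitseqs k')
  else [:: [::]].

Lemma mem_bitseqs k b : (b \in bitseqs k) = (size b <= k)%N.
Proof.
have cons_inj (x : bool) : injective (cons x) by move=> s t [].
have cons_neq (x : bool) c s : (x :: c \in map (cons (~~ x)) s) = false.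
  by apply/negbTE/mapP => -[c' _ []]; case: x.
elim: k b => [|k IHk] [|x b] //=; rewrite inE /= mem_cat ltnS -IHk.
by case: x; rewrite (mem_map (@cons_inj _)) ?(cons_neq true) ?(cons_neq false) ?orbF.
Qed.

Section Maurey.
Variables (K : numFieldType) (X : topologicalLmodType K) (U : nat -> set X).
Hypothesis hU : balanced_base U.
Variable F : set K.
Hypothesis hF : subring_set F.
Hypothesis dF : forall c d : K, 0 < d -> exists2 f, F f & `|c - f| < d.
Hypothesis no_line : forall x : X, x <> 0 -> exists c : K, ~ U 0 (c *: x).
Variable d : nat -> X.
Implicit Types (V W Z : set X) (s t : seq nat).

(** All the vectors have a code through [d]: this leaves countably many
    conditions to stabilize. *)
Definition coded_space Z := [/\ submodule F Z, big Z & Z `<=` range d].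

(** Separation of the sums [E_s + V] and [E_t + W], where [E_s] and [E_t] are the
    submodules generated by the vectors coded in [s] and in [t]. *)
Definition sep_over s t m n V W :=
  sep U m n (addlines F (map d s) V) (addlines F (map d t) W).

(** The pair [(E_s, E_t)] can be continued inside the space at hand. *)
Definition extends s t m n := contains_pair coded_space (sep_over s t m n).

Lemma extendsC s t m n Z : extends s t m n Z -> extends t s m n Z.
Proof.
move=> [V [W [cV cW VZ WZ VW]]]; exists W, V; split => // w v hw hv.
by rewrite addrC => /(VW _ _ hv hw)[].
Qed.

Lemma extends_stable Z0 : coded_space Z0 -> exists Z, [/\ coded_space Z, Z `<=` Z0 &
  forall s t m n, extends s t m n Z -> forall Z', coded_space Z' -> Z' `<=` Z ->
    extends s t m n Z'].
Proof.
move=> cZ0.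
pose R k : set X -> set X -> Prop :=
  if @unpickle (seq nat * seq nat * nat * nat)%type k is Some (s, t, m, n)
  then sep_over s t m n else fun _ _ => True.
have [|Z [cZ ZZ0 hZ]] := fusion_stabilize (R := R)
    (fusion_submodule hF) _ cZ0.
  move=> k V W V' W'; rewrite /R; case: unpickle => // -[[[s t] m] n] VW V'V W'W.
  by apply: sepS VW _ _; exact: addlinesS.
exists Z; split => // s t m n.
by have := hZ (pickle (s, t, m, n)); rewrite /R pickleK.
Qed.

Variable Z : set X.
Hypothesis cZ : coded_space Z.
Hypothesis stable : forall s t m n, extends s t m n Z ->
  forall Z', coded_space Z' -> Z' `<=` Z -> extends s t m n Z'.
Variable mu : nat -> nat.
Hypothesis hmu : forall n, extends [::] [::] (mu n) n.+1 Z.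

(** Given the first condition of [L], stability provides a continuation [(S, T)]
    inside the space [V] obtained for the other ones, and any vector of [S] may
    be moved from [S] to [E_s]. Shrinking the space once for each condition, a
    single vector serves all of them. *)
Lemma common_extension (L : seq (seq nat * seq nat * nat * nat)) :
  (forall s t m n, (s, t, m, n) \in L -> extends s t m n Z) ->
  exists V, [/\ coded_space V, V `<=` Z & forall c, V (d c) ->
    forall s t m n, (s, t, m, n) \in L -> extends (c :: s) t m n Z].
Proof.
elim: L => [|[[[s t] m] n] L IHL] hL; first by exists Z; split.
have [s' t' m' n' h|V [cV VZ hV]] := IHL.
  by apply: hL; rewrite inE h orbT.
have [S [T [cS cT SV TV ST]]] := stable (hL s t m n (mem_head _ _)) cV VZ.
exists S; split => //; first exact: subset_trans VZ.
move=> c Sc s' t' m' n'; rewrite inE => /orP[/eqP[-> -> -> ->]|]; last first.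
  by apply: hV; exact: SV.
exists S, T; split => //; [exact: subset_trans VZ|exact: subset_trans VZ|].
apply: sepS ST _ _ => //=; have [sS _ _] := cS.
have sS' := submodule_addlines (map d s) hF sS.
move=> _ [a [z [Fa Sz ->]]]; case: (sS') => _; apply => //.
exact: (sub_addlines _ hF).
Qed.

(** The multiple of a vector that leaves [U 0] can be taken with a coefficient
    in [F], since [U 0] is balanced and [F] is unbounded, being dense. *)
Lemma outside_base V : submodule F V -> big V -> exists2 x, V x & ~ U 0 x.
Proof.
move=> sV [z Vz iz]; have [c hc] := no_line (independent_neq0 iz (i := 0%N)).
have [f Ff cf] := dF (`|c| + 1) (ltr01 : 0 < 1 :> K).
have lt_cf : `|c| < `|f|.
  have h := ler_normD (`|c| + 1 - f) f; rewrite subrK ger0_norm ?addr_ge0 // in h.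
  by rewrite -(ltrD2r 1) (le_lt_trans h) // addrC ltrD2l.
have f0 : f != 0 by rewrite -normr_gt0 (le_lt_trans _ lt_cf).
exists (f *: z 0%N); first exact: (submoduleZ sV).
move=> Ux; apply: hc; rewrite -[c](divfK f0) -scalerA.
apply: (base_balanced hU) => //.
by rewrite normrM normfV ler_pdivrMr ?mul1r ?normr_gt0 // ltW.
Qed.

(** The vectors are chosen one by one, so that for every [j] and every partition
    of the indices from [j] on into two sets, the corresponding pair of
    submodules can still be continued with constants [mu j] and [j.+1]. A mask
    [b] for the first terms of the list [t], latest first, encodes both [j],
    through its size, and the partition. Only the tail from [j] on is subject to
    the [j]-th condition, so that there are finitely many conditions at each
    step. *)
Lemma maurey_sequence : exists e : nat -> X, (forall i, ~ U 0 (e i)) /\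
  forall j N (a : nat -> K) (A : pred nat), (forall i, F (a i)) ->
    U (mu j) (\sum_(j <= i < N) a i *: e i) ->
    U j.+1 (\sum_(j <= i < N | A i) a i *: e i).
Proof.
have [|t [tU ht]|y hy] := @seq_choice nat (fun t =>
  (forall c, c \in t -> ~ U 0 (d c)) /\
  forall b, (size b <= size t)%N ->
    extends (mask b t) (mask (map negb b) t)
      (mu (size t - size b)) (size t - size b).+1 Z).
- by split => // -[|//] _; exact: hmu.
- pose L := [seq (mask b t, mask (map negb b) t, mu (size t - size b),
    (size t - size b).+1) | b <- bitseqs (size t)].
  have [|V [cV VZ hV]] := @common_extension L.
    move=> s s' m n /mapP[b]; rewrite mem_bitseqs => bt [-> -> -> ->].
    exact: ht.
  have [sV bV Vd] := cV; have [x Vx Ux] := outside_base sV bV.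
  have [c _ dc] := Vd x Vx; exists c; split.
    by move=> c'; rewrite inE => /orP[/eqP->|/tU//]; rewrite dc.
  have hc b : (size b <= size t)%N -> extends (c :: mask b t) (mask (map negb b) t)
      (mu (size t - size b)) (size t - size b).+1 Z.
    move=> bt; apply: hV; first by rewrite dc.
    by apply/mapP; exists b => //; rewrite mem_bitseqs.
  move=> [|[] b] /=; first by rewrite subn0 => _; exact: hmu.
    by rewrite subSS; exact: hc.
  (* adding x on the other side amounts to complementing the mask *)
  rewrite subSS ltnS => bt; apply: extendsC.
  have := hc (map negb b); rewrite size_map => /(_ bt).
  by rewrite (mapK negbK).
pose e i := d (y i); exists e; split.
  by move=> i; case: (hy i.+1) => + _; apply; rewrite /= mem_head.
move=> j N a A Fa Us; have [Nj|jN] := leqP N j.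
  by rewrite big_geq //; exact: base0.
rewrite -(subnKC (ltnW jN)) in Us *; move: (N - j)%N Us => l {N jN} Us.
have memA (B : pred nat) V : V 0 -> addlines F
    (map d (mask (past (fun i => B (j + i)%N) l) (past y (j + l)%N))) V
    (\sum_(j <= i < j + l | B i) a i *: e i).
  move=> V0; elim: l {Us} => [|l IHl]; first by rewrite addn0 big_geq.
  rewrite addnS /= big_mkcond big_nat_recr ?leq_addr //= -big_mkcond.
  case: (B (j + l)%N) => /=; last by rewrite addr0.
  by exists (a (j + l)%N), (\sum_(j <= i < j + l | B i) a i *: e i); rewrite addrC.
have szb : size (past (fun i => A (j + i)%N) l) = l by rewrite size_past.
have [_ /(_ (past (fun i => A (j + i)%N) l))] := hy (j + l)%N.
rewrite !size_past leq_addl addnK => /(_ isT)[V [W [[[V0 _] _ _] [[W0 _] _ _] _ _ VW]]].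
have negA : map negb (past (fun i => A (j + i)%N) l) =
    past (fun i => ~~ A (j + i)%N) l.
  by elim: (l) => //= l' ->.
have [] // := VW _ _ (memA A V V0) (_ : _ (\sum_(j <= i < j + l | ~~ A i) a i *: e i)).
  by rewrite negA; exact: (memA (fun i => ~~ A i)).
by move: Us; rewrite (bigID A).
Qed.

End Maurey.

Section DenseScalars.
Variables (K : numFieldType) (X : topologicalLmodType K) (U : nat -> set X).
Hypothesis hU : balanced_base U.
Variable F : set K.
Hypothesis dF : forall c d : K, 0 < d -> exists2 f, F f & `|c - f| < d.

(** Coefficients in [F] are replaced by arbitrary ones at the cost of one
    neighbourhood. For [j = 0] the conclusion bounds each coefficient, because
    no [e i] lies in [U 0]. *)
Lemma suppressible_of_dense (e : nat -> X) (mu : nat -> nat) :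
  (forall i, ~ U 0 (e i)) ->
  (forall j N (a : nat -> K) (A : pred nat), (forall i, F (a i)) ->
    U (mu j) (\sum_(j <= i < N) a i *: e i) ->
    U j.+1 (\sum_(j <= i < N | A i) a i *: e i)) ->
  suppressible U e /\ forall i, e i <> 0.
Proof.
move=> eU he.
have hK j N (a : nat -> K) (A : pred nat) :
    U (mu j).+1 (\sum_(j <= i < N) a i *: e i) ->
    U j (\sum_(j <= i < N | A i) a i *: e i).
  move=> Us; pose p := maxn (mu j).+1 j.+1.
  have /choice[f hf] : forall i, exists f, F f /\ U (p + i).+1 ((a i - f) *: e i).
    move=> i; have [c c0 hc] := base_absorb hU (p + i).+1 (e i).
    by have [f Ff af] := dF (a i) c0; exists f; split => //; apply: hc; exact: ltW.
  have Up (B : pred nat) : U p (\sum_(j <= i < N | B i) (a i - f i) *: e i).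
    apply: base_sum => // i ji _; case: (hf i) => _; apply: base_le => //.
    by rewrite ltnS leq_add2l leq_subr.
  have Ff i : F (f i) by case: (hf i).
  have E (B : pred nat) : \sum_(j <= i < N | B i) a i *: e i =
      \sum_(j <= i < N | B i) f i *: e i + \sum_(j <= i < N | B i) (a i - f i) *: e i.
    by rewrite -big_split /=; apply: eq_bigr => i _; rewrite -scalerDl addrC subrK.
  rewrite E; apply: (base_add hU).
    apply: he => //; have -> : \sum_(j <= i < N) f i *: e i =
      \sum_(j <= i < N) a i *: e i - \sum_(j <= i < N) (a i - f i) *: e i.
      by rewrite (E predT) addrK.
    by apply: (base_sub hU) => //; apply: base_le (Up predT) => //; exact: leq_maxl.
  by apply: base_le (Up A) => //; exact: leq_maxr.
have bc i : bounded_coef U e i.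
  exists (mu 0%N).+1, 1 => // N a iN /(hK 0%N N a (pred1 i)).
  by rewrite big_nat1_eq iN; exact: base_coef_lt1.
split; last by move=> i; exact: bounded_coef_neq0 (bc i).
apply: suppressible_of_tail => // n; exists n, (mu n).+1 => N a A.
exact: hK.
Qed.

End DenseScalars.

(** * The dichotomy over a complete field with a countable dense subring *)

Section Dichotomy.
Variables (R : realType) (K : numFieldType) (g : nat -> K).
Hypothesis hK : cauchy_complete K.
Hypothesis hg : subring_set (range g).
Hypothesis dg : forall c d : K, 0 < d -> exists2 f, range g f & `|c - f| < d.

Lemma seq_span_countable (X : lmodType K) (y : nat -> X) :
  exists d : nat -> X, seq_span (range g) y `<=` range d.
Proof.
pose d k := if @unpickle (seq nat) k is Some s
  then \sum_(0 <= i < size s) g (nth 0%N s i) *: y i else 0.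
exists d => _ [N [a [ga ->]]].
have /choice[c hc] : forall i, exists k, g k = a i.
  by move=> i; have [k _ <-] := ga i; exists k.
exists (pickle (mkseq c N)) => //; rewrite /d pickleK size_mkseq.
by apply: eq_big_nat => i /andP[_ iN]; rewrite nth_mkseq // hc.
Qed.

(** If some [U0 n0] contains no line, shift the base so that it becomes [U 0].
    The construction takes place in the submodule generated by an independent
    sequence of the space [Y] given by [uniform_pairs]. *)
Theorem gowers_dichotomy (X : topologicalLmodType K) : metrizable R X ->
  infinite_dim [set: X] ->
  ~ (exists e : nat -> X, unconditional_basic_sequence e) ->
  exists Y : set X, [/\ linear_subspace Y, closed Y, infinite_dim Y
    & hereditarily_indecomposable Y].
Proof.
move=> /(@metrizable_base K)[U0 hU0] iX nU; apply: contrapT => noY.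
have no_hi (Y : set X) : linear_subspace Y -> closed Y -> infinite_dim Y ->
    ~ hereditarily_indecomposable Y.
  by move=> lY cY iY hY; apply: noY; exists Y.
have [n0 hn0] : exists n0, forall x : X, x <> 0 -> exists c : K, ~ U0 n0 (c *: x).
  apply: contrapT => /forallNP h; apply: nU.
  apply: (short_lines_unconditional hU0 hK) => n.
  have /existsNP[x /not_implyP[x0 hx]] := h n; exists x => // c.
  by apply: contrapT => nUc; apply: hx; exists c.
pose U n := U0 (n0 + n)%N; have hU := balanced_base_shift n0 hU0.
have no_line (x : X) : x <> 0 -> exists c : K, ~ U 0%N (c *: x).
  by rewrite /U addn0; exact: hn0.
have cX : closed_space [set: X].
  by split; [|exact: closedT|exact: infinite_dim_big].
have [Y [m [cY hY]]] := uniform_pairs hU hK no_hi cX.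
have [sY _ [y Yy iy]] := cY.
have [d hd] := seq_span_countable y.
have sub T : submodule setT T -> submodule (range g) T.
  by move=> [T0 hT]; split => // a u v _; exact: hT.
have DY : seq_span (range g) y `<=` Y by apply: span_sub => //; exact: sub.
have cD : coded_space (range g) d (seq_span (range g) y).
  by split => //; [exact: submodule_span|exact: big_span].
have [Z [cZ ZD stable]] := extends_stable U hg cD.
have hmu n : exists q, extends U (range g) d [::] [::] q n.+1 Z.
  have [sZ bZ Zd] := cZ.
  have ZY := subset_trans ZD DY.
  have hsplit T (cT : closed_space T) (_ : T `<=` Y) := split_closed hU no_hi cT.
  have [q hq] := split_submodule hU no_line hg dg n.+1 hY hsplit cY ZY Zd sZ bZ.
  by exists q; exact: hq.
have /choice[mu hmu'] := hmu.
have [e [eU he]] := maurey_sequence hU hg dg no_line cZ stable hmu'.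
have [se e0] := suppressible_of_dense hU dg eU he.
by apply: nU; exists e; exact: (suppressible_unconditional hU hK).
Qed.

End Dichotomy.

(** * Real and complex scalars *)

Lemma real_cauchy_complete (R : realType) : cauchy_complete R.
Proof.
move=> a ha.
have /cvg_ex[l al] : cvg (a @ \oo).
  apply/cauchy_cvgP; apply: cauchy_exP => e e0; have [N hN] := ha e e0.
  by exists (a N), N => // k Nk; exact: hN.
exists l => e e0; have [N _ hN] := (cvgrPdist_lt _ _).1 al e e0.
by exists N => i Ni; rewrite distrC; exact: hN.
Qed.

Definition rat_code (R : realType) k : R := oapp ratr 0 (@unpickle rat k).

Lemma subring_rat (R : realType) : subring_set (range (@rat_code R)).
Proof.
have memq q : range (@rat_code R) (ratr q).
  by exists (pickle q) => //; rewrite /rat_code pickleK.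
have qmem x : range (@rat_code R) x -> exists q, x = ratr q.
  move=> [k _ <-]; rewrite /rat_code; case: unpickle => [q|] /=; first by exists q.
  by exists 0; rewrite raddf0.
split; first by rewrite -(rmorph1 (@ratr R)); exact: memq.
- by move=> _ _ /qmem[p ->] /qmem[q ->]; rewrite -rmorphB; exact: memq.
- by move=> _ _ /qmem[p ->] /qmem[q ->]; rewrite -rmorphM; exact: memq.
Qed.

Lemma dense_rat_code (R : realType) (c d : R) : 0 < d ->
  exists2 f, range (@rat_code R) f & `|c - f| < d.
Proof.
move=> d0; have /rat_in_itvoo[q /itvP hq] : c - d < c + d.
  by rewrite ltrD2l gtrN.
exists (ratr q); first by exists (pickle q) => //; rewrite /rat_code pickleK.
by rewrite distrC ltr_distl !hq.
Qed.

Section Complex.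
Local Open Scope complex_scope.
Variable R : realType.

Lemma norm_real (x : R) : `|x%:C| = `|x|%:C.
Proof. by rewrite normc_def /= expr0n addr0 sqrtr_sqr. Qed.

Lemma norm_i : `|'i : R[i]| = 1.
Proof. by rewrite normc_def /= expr0n expr1n add0r sqrtr1. Qed.

Lemma normc_ge_Im (z : R[i]) : `|complex.Im z|%:C <= `|z|.
Proof.
have := normc_ge_Re (z * 'i); rewrite ReiNIm normrN.
by rewrite normrM norm_i mulr1.
Qed.

Lemma normc_le (z : R[i]) : `|z| <= (`|complex.Re z| + `|complex.Im z|)%:C.
Proof.
rewrite [in leLHS](complexE z) (le_trans (ler_normD _ _)) //.
by rewrite normrM norm_i mul1r !norm_real -rmorphD.
Qed.

Lemma pos_complex (e : R[i]) : 0 < e -> exists2 r : R, 0 < r & e = r%:C.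
Proof.
case: e => a b; rewrite ltcE /= => /andP[/eqP-> a0].
by exists a.
Qed.

Lemma complex_cauchy_complete : cauchy_complete R[i].
Proof.
move=> a ha.
have [|x hx] := @real_cauchy_complete R (fun k => complex.Re (a k)).
  move=> e e0; have [|N hN] := ha e%:C; first by rewrite ltcR.
  exists N => i j iN jN; rewrite -ltcR; apply: le_lt_trans (hN i j iN jN).
  by rewrite -raddfB; exact: normc_ge_Re.
have [|y hy] := @real_cauchy_complete R (fun k => complex.Im (a k)).
  move=> e e0; have [|N hN] := ha e%:C; first by rewrite ltcR.
  exists N => i j iN jN; rewrite -ltcR; apply: le_lt_trans (hN i j iN jN).
  by rewrite -raddfB; exact: normc_ge_Im.
exists (x +i* y) => _ /pos_complex[e e0 ->].
have e20 : 0 < e / 2 by rewrite divr_gt0.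
have [N hN] := hx _ e20; have [M hM] := hy _ e20.
exists (maxn N M) => i; rewrite geq_max => /andP[/hN ix /hM iy].
apply: le_lt_trans (normc_le _) _; rewrite ltcR [e]splitr.
by rewrite !raddfB /=; exact: ltrD.
Qed.

Definition complex_rat_code k : R[i] :=
  oapp (fun p => ratr p.1 +i* ratr p.2) 0 (@unpickle (rat * rat)%type k).

Lemma subring_complex_rat : subring_set (range complex_rat_code).
Proof.
have memq p q : range complex_rat_code (ratr p +i* ratr q).
  by exists (pickle (p, q)) => //; rewrite /complex_rat_code pickleK.
have qmem x : range complex_rat_code x -> exists p q, x = ratr p +i* ratr q.
  move=> [k _ <-]; rewrite /complex_rat_code; case: unpickle => [[p q]|] /=.
    by exists p, q.
  by exists 0, 0; rewrite !raddf0.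
split.
- by have := memq 1 0; rewrite rmorph1 raddf0.
- move=> _ _ /qmem[p [q ->]] /qmem[p' [q' ->]].
  by have := memq (p - p') (q - q'); rewrite !rmorphB.
- move=> _ _ /qmem[p [q ->]] /qmem[p' [q' ->]].
  have := memq (p * p' - q * q') (p * q' + q * p').
  by rewrite rmorphB rmorphD !rmorphM.
Qed.

Lemma dense_complex_rat (c d : R[i]) : 0 < d ->
  exists2 f, range complex_rat_code f & `|c - f| < d.
Proof.
move=> /pos_complex[e e0 ->]; have e20 : 0 < e / 2 by rewrite divr_gt0.
have qap (x : R) : exists q : rat, `|x - ratr q| < e / 2.
  have [_ [k _ <-]] := dense_rat_code x e20; rewrite /rat_code.
  case: unpickle => [q|] /=; first by exists q.
  by exists 0; rewrite raddf0.
have [p hp] := qap (complex.Re c); have [q hq] := qap (complex.Im c).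
exists (ratr p +i* ratr q).
  by exists (pickle (p, q)) => //; rewrite /complex_rat_code pickleK.
apply: le_lt_trans (normc_le _) _; rewrite ltcR [e]splitr.
by rewrite !raddfB /=; exact: ltrD.
Qed.

End Complex.

Theorem theorem5p7 (R : realType) :
  (forall X : topologicalLmodType R,
     F_space R X -> infinite_dim [set: X] ->
     ~ (exists e : nat -> X, unconditional_basic_sequence e) ->
     exists Y : set X,
       [/\ linear_subspace Y, closed Y, infinite_dim Y
         & hereditarily_indecomposable Y]) /\
  (forall X : topologicalLmodType R[i],
     F_space R X -> infinite_dim [set: X] ->
     ~ (exists e : nat -> X, unconditional_basic_sequence e) ->
     exists Y : set X,
       [/\ linear_subspace Y, closed Y, infinite_dim Y
         & hereditarily_indecomposable Y]).
Proof.
split=> X [mX _].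
  apply: (@gowers_dichotomy R R (@rat_code R) _ _ _ X mX).
  - exact: real_cauchy_complete.
  - exact: subring_rat.
  - exact: dense_rat_code.
apply: (@gowers_dichotomy R R[i] (@complex_rat_code R) _ _ _ X mX).
- exact: complex_cauchy_complete.
- exact: subring_complex_rat.
- exact: dense_complex_rat.
Qed.
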